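(* For every integer $J\ge 1$ there is a triangulation $\mathcal{T}_J$ of a square in $\mathbb{R}^2$ into $8J+4$ triangles such that the norm of the $L_2$-orthogonal projector $P_{V(\mathcal{T}_J)}$ onto the space $V(\mathcal{T}_J)$ of continuous piecewise linear functions on $\mathcal{T}_J$ satisfies $$\|P_{V(\mathcal{T}_J)}\|_{L_\infty\to L_\infty}\ge 2J.$$ Thus, for spatial dimension $d=2$, $$C(1):=\sup_{\mathcal{T}}\|P_{V(\mathcal{T})}\|_{L_\infty\to L_\infty}=\infty,$$ where the supremum is taken over all finite triangulations $\mathcal{T}$ of bounded polygonal domains in $\mathbb{R}^2$.
   Context: Let $\Omega\subset\mathbb{R}^2$ be a bounded polygonal domain (taken with its boundary, e.g. a closed square). A triangulation $\mathcal{T}$ of $\Omega$ is a finite set of non-degenerate closed triangles whose union is $\Omega$ and which satisfies the usual regularity condition: two different triangles of $\mathcal{T}$ are either disjoint or intersect exactly in a common vertex or a common edge. $V(\mathcal{T})$ denotes the linear space of all continuous functions $g:\Omega\to\mathbb{R}$ whose restriction to each triangle $\Delta\in\mathcal{T}$ is a linear polynomial (i.e. a polynomial of degree at most one, an affine function). $P_{V(\mathcal{T})}:L_2(\Omega)\to V(\mathcal{T})$ is the orthogonal projection with respect to the $L_2(\Omega)$ inner product $(\cdot,\cdot)$ (Lebesgue measure): $P_{V(\mathcal{T})}f$ is the unique $g\in V(\mathcal{T})$ with $(f-g,\phi)=0$ for all $\phi\in V(\mathcal{T})$. Its $L_\infty$-norm is $$\|P_{V(\mathcal{T})}\|_{L_\infty\to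 L_\infty}:=\max_{f\in L_\infty(\Omega):\,\|f\|_{L_\infty}=1}\|P_{V(\mathcal{T})}f\|_{L_\infty}.$$ *)

(* Defs.v *)
From HB Require Import structures.
From mathcomp Require Import all_boot all_order all_algebra.
From mathcomp Require Import all_classical all_reals all_analysis.

Set Implicit Arguments.
Unset Strict Implicit.
Unset Printing Implicit Defensive.

Import Order.TTheory GRing.Theory Num.Theory.
Import numFieldNormedType.Exports.

Local Open Scope classical_set_scope.
Local Open Scope ring_scope.

Definition segment (R : realType) (a b : R * R) : set (R * R) :=
  [set p | exists2 t : R, 0 <= t <= 1 & p = (1 - t) *: a + t *: b].

Definition triangle (R : realType) (a b c : R * R) : set (R * R) :=
  [set p | exists s t u : R, [/\ 0 <= s, 0 <= t, 0 <= u, s + t + u = 1 &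
                                 p = s *: a + t *: b + u *: c]].

(* The determinant of (b - a, c - a) is nonzero. *)
Definition noncollinear (R : realType) (a b c : R * R) : Prop :=
  (b.1 - a.1) * (c.2 - a.2) - (b.2 - a.2) * (c.1 - a.1) != 0.

Definition is_triangle (R : realType) (D : set (R * R)) : Prop :=
  exists a b c : R * R, noncollinear a b c /\ D = triangle a b c.

Definition is_vertex (R : realType) (D : set (R * R)) (a : R * R) : Prop :=
  exists b c : R * R, noncollinear a b c /\ D = triangle a b c.

Definition is_edge (R : realType) (D e : set (R * R)) : Prop :=
  exists a b c : R * R,
    [/\ noncollinear a b c, D = triangle a b c & e = segment a b].

Definition triangulation (R : realType) (O : set (R * R))
    (T : set (set (R * R))) : Prop :=
  [/\ finite_set T,
      forall D, T D -> is_triangle D,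
      \bigcup_(D in T) D = O &
      forall D D', T D -> T D' -> D <> D' ->
        [\/ D `&` D' = set0,
            exists a, [/\ is_vertex D a, is_vertex D' a & D `&` D' = [set a]] |
            is_edge D (D `&` D') /\ is_edge D' (D `&` D')]].

(* A bounded domain is taken together with its boundary, i.e. as the closure of
   a nonempty connected open set; polygonal means that its boundary is a finite
   union of segments. *)
Definition polygonal_domain (R : realType) (O : set (R * R)) : Prop :=
  [/\ bounded_set O, O° !=set0, connected O°, O = closure O° &
      exists s : seq ((R * R) * (R * R)),
        O `\` O° = \bigcup_(e in [set` s]) segment e.1 e.2].

Definition is_square (R : realType) (Q : set (R * R)) : Prop :=
  exists a u : R * R, u != 0 /\
    Q = [set p | exists s t : R, [/\ 0 <= s <= 1, 0 <= t <= 1 &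
                   p = a + s *: u + t *: ((- u.2, u.1) : R * R)]].

(* Two-dimensional Lebesgue measure, on the Borel sets of the plane. *)
Definition lebesgue2 (R : realType) :
    {measure set (measurableTypeR R * measurableTypeR R) -> \bar R} :=
  (@lebesgue_measure R \x @lebesgue_measure R)%E.

(* A function on O is encoded by a function on the whole plane; only its values
   on O matter here, and membership in Linf O is finiteness of this norm. *)
Definition normLinf (R : realType) (O : set (R * R)) (f : R * R -> R) : \bar R :=
  ('N[lebesgue2 R]_+oo[EFin \o f \_ O])%E.

Definition inner (R : realType) (O : set (R * R)) (f g : R * R -> R) : R :=
  \int[lebesgue2 R]_(p in O) (f p * g p).

(* V(T), for a triangulation T of O.  The last clause makes the encoding of a
   function on O by a function on the plane unique. *)
Definition pwlinear (R : realType) (O : set (R * R)) (T : set (set (R * R))) :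
    set (R * R -> R) :=
  [set g | [/\ {within O, continuous g},
               forall D, T D -> exists k l m : R,
                 forall p, D p -> g p = k + l * p.1 + m * p.2 &
               forall p, ~ O p -> g p = 0]].

(* The orthogonal projection of f in L2(O) onto V(T): the element g of V(T)
   such that f - g is orthogonal to V(T), which exists and is unique when T is
   a triangulation of O. *)
Definition projV (R : realType) (O : set (R * R)) (T : set (set (R * R)))
    (f : R * R -> R) : R * R -> R :=
  get [set g | pwlinear O T g /\
               forall phi, pwlinear O T phi -> inner O (f \- g) phi = 0].

(* For a triangulation this supremum is attained, V(T) being
   finite-dimensional. *)
Definition norm_projV (R : realType) (O : set (R * R)) (T : set (set (R * R))) :
    \bar R :=
  ereal_sup [set normLinf O (projV O T f) | f in
    [set f : R * R -> R |
       measurable_fun (O : set (measurableTypeR R * measurableTypeR R)) f /\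
       normLinf O f = 1%E]].

Definition C1 (R : realType) : \bar R :=
  ereal_sup [set N | exists O T,
    [/\ polygonal_domain O, triangulation O T & N = @norm_projV R O T]].

(* Main.v *)
Require Import Defs.
From mathcomp Require Import all_boot all_order all_algebra.
From mathcomp Require Import all_classical all_reals all_analysis.
From mathcomp Require Import measurable_realfun ess_sup_inf.
From mathcomp Require Import ring lra zify.

(** Let [n = J + 1].  The squares of half-sides [0 = rho 0 < ... < rho n]
    around the origin cut the largest one into [n] annuli.  The rays through
    the corners cut an annulus into four trapezoids, and a diagonal cuts each
    trapezoid into two triangles, except around the origin, where the trapezoids
    are triangles already; this makes [4 * (2 * n - 1) = 8 * J + 4] triangles.
    The diagonals are chosen such that the quarter turn [rot] preserves the
    triangulation.

    Averaging over the four quarter turns makes everything one-dimensional.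
    The average of a function of [V] takes one value at the four vertices of
    each level, so on both triangles of a trapezoid it interpolates linearly,
    as a function of the max norm, between two such values
    ([average_pwlinear]).  Since the Lebesgue measure is invariant under [rot],
    the inner product of a radial function [eta `|p|] with a function of [V]
    is the integral of [8 * r * eta r] times that interpolation
    ([inner_radial]).  For a radial step function the orthogonality relations
    thus become a tridiagonal system for the averages [x 0, ..., x n], whose
    rows are values of [residual] ([inner_residual]).  The system is positive
    definite, hence solvable ([exists_residual0]), and the radial function with
    the values [x] is the projection of the step function
    ([exists_projection]); conversely the averages of the projection solve the
    system ([residual_average]).

    The step function is chosen equal to [(-1) ^+ i] on the annulus between the
    levels [i] and [i + 1], and [rho] geometric with a large ratio.  Then the
    row of level [i < n] is dominated by the four large triangles of the next
    annulus that have a side on its outer boundary.  They make it a multiple of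
    [x i + x (i + 1) - 2 * (-1) ^+ i], up to a small error.  The row of level
    [n] is, up to a small error, a multiple of
    [3 * x n + x (n - 1) - 4 * (-1) ^+ (n - 1)].  So [x n] is close to
    [(-1) ^+ (n - 1)] and [(-1) ^+ i * x i] grows by about [2] with every step
    inwards, up to about [2 * n - 1 = 2 * J + 1] at the origin.  In
    [residual_blowup] this is proved by contradiction: as long as all the
    averages are bounded by [2 * J], so are the errors.  An average beyond
    [2 * J] needs a value beyond [2 * J] at some vertex, and by continuity the
    essential supremum of the projection is at least [2 * J]
    ([ae_le_square], [norm_projV_ge]). *)

Set Implicit Arguments.
Unset Strict Implicit.
Unset Printing Implicit Defensive.

Import Order.TTheory GRing.Theory Num.Theory.
Import numFieldNormedType.Exports.

Local Open Scope classical_set_scope.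
Local Open Scope ring_scope.

(** * The reduced system *)

Section Discrete.
Variable R : realType.
Implicit Types (a b e y : R) (rho s x v : nat -> R).

(** Let one affine function take the values [e, e'] at the radii [a, b] and
    another one the values [y, y'].  This is 3/2 of the integral over [a, b] of
    [8 * r] times their product ([Rintegral_cell]); [8 * r] is the perimeter of
    the square of half-side [r]. *)
Definition cell a b e e' y y' : R :=
  (b - a) * (b * (3 * e' * y' + e' * y + e * y' + e * y) +
             a * (3 * e * y + e * y' + e' * y + e' * y')).

(** 3/2 of the inner product of [f - g] with [phi], where [f] is the radial
    function equal to [s i] on the annulus [i], and [x] and [v] are the averages
    of [g] and [phi] over the vertices of each level ([inner_residual]). *)
Definition residual rho n s x v : R :=
  \sum_(i < n) cell (rho i) (rho i.+1) (s i - x i) (s i - x i.+1) (v i) (v i.+1).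

Definition unit_at j : nat -> R := fun i => (i == j)%:R.

Lemma cellC a b e e' y y' : cell a b e e' y y' = cell a b y y' e e'.
Proof. by rewrite /cell; ring. Qed.

Lemma cell_ge0 a b e e' : 0 <= a < b -> 0 <= cell a b e e' e e'.
Proof.
move=> /andP[a0 ab]; rewrite /cell; apply: mulr_ge0; first by lra.
by apply: addr_ge0; apply: mulr_ge0; nra.
Qed.

Lemma cell_eq0 a b e e' : 0 <= a < b -> cell a b e e' e e' = 0 ->
  e = 0 /\ e' = 0.
Proof.
move=> /andP[a0 ab]; rewrite /cell => /eqP.
rewrite mulf_eq0 subr_eq0 gt_eqF//= paddr_eq0; last 2 first.
- by apply: mulr_ge0; nra.
- by apply: mulr_ge0; nra.
case/andP; rewrite mulf_eq0 => /orP[/eqP b0|/eqP h] _; first by lra.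
(* both brackets in the definition of [cell] have this form on the diagonal *)
have {}h : e' ^+ 2 *+ 2 + (e + e') ^+ 2 = 0 by rewrite -[RHS]h; ring.
move/eqP: h; rewrite paddr_eq0 ?mulrn_wge0 ?sqr_ge0// mulrn_eq0 !sqrf_eq0/=.
by case/andP => /eqP-> /eqP; rewrite addr0.
Qed.

Lemma residual_sumr rho n s x v :
  residual rho n s x v = \sum_(j < n.+1) v j * residual rho n s x (unit_at j).
Proof.
have E m : (m <= n)%N -> v m = \sum_(j < n.+1) v j * unit_at j m.
  move=> mn; have mn' : (m < n.+1)%N by [].
  rewrite (bigD1 (Ordinal mn'))//= [unit_at m m]/unit_at eqxx mulr1.
  rewrite big1 ?addr0// => j; rewrite -val_eqE/= => jm.
  by rewrite /unit_at eq_sym (negbTE jm) mulr0.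
under eq_bigr do rewrite mulr_sumr.
rewrite exchange_big/=; apply: eq_bigr => i _.
rewrite (E i) 1?ltnW// (E i.+1)// /cell.
set A := s i - x i; set B := s i - x i.+1; set a := rho i; set b := rho i.+1.
transitivity ((b - a) * (b * (A + B) + a * (3 * A + B)) *
    (\sum_(j < n.+1) v j * unit_at j i) +
  (b - a) * (b * (3 * B + A) + a * (A + B)) *
    \sum_(j < n.+1) v j * unit_at j i.+1); first by ring.
by rewrite !mulr_sumr -big_split/=; apply: eq_bigr => j _; ring.
Qed.

(** The matrix of the system is a Gram matrix.  A vector in its kernel has
    energy 0, and each cell is a positive definite form in the two values at its
    ends. *)
Lemma exists_residual0 rho n s : (0 < n)%N -> 0 <= rho 0%N ->
  (forall i, rho i < rho i.+1) ->
  exists x, forall v, residual rho n s x v = 0.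
Proof.
move=> n0 rho0 rhoS.
have rho_ge0 i : 0 <= rho i < rho i.+1.
  rewrite rhoS andbT; elim: i => // i /le_trans; apply; exact/ltW/rhoS.
pose B (x v : nat -> R) := \sum_(i < n) cell (rho i) (rho i.+1) (x i) (x i.+1) (v i) (v i.+1).
have residualB s' x v : residual rho n s' x v = residual rho n s' (fun=> 0) v - B x v.
  rewrite /residual /B -sumrB; apply: eq_bigr => i _; rewrite /cell; ring.
have BC x v : B x v = B v x by apply: eq_bigr => i _; exact: cellC.
have Bsum x v : B x v = \sum_(j < n.+1) v j * B x (unit_at j).
  have := residual_sumr rho n (fun=> 0) x v; rewrite residualB.
  have Z w : residual rho n (fun=> 0) (fun=> 0) w = 0.
    by rewrite /residual big1// => i _; rewrite /cell !subr0 !(mul0r,mulr0,addr0).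
  rewrite Z sub0r; under eq_bigr do rewrite residualB Z sub0r mulrN.
  by rewrite sumrN => /oppr_inj.
pose M : 'M[R]_n.+1 := \matrix_(i, j) B (unit_at i) (unit_at j).
pose ext (u : 'rV[R]_n.+1) : nat -> R := fun i => u ord0 (inord i).
have extM u j : (u *m M) ord0 j = B (ext u) (unit_at j).
  rewrite mxE BC Bsum; apply: eq_bigr => i _; rewrite mxE /ext inord_val; congr *%R.
  exact: BC.
have Mu : M \in unitmx.
  rewrite -row_free_unit; apply: inj_row_free => u uM0.
  have : B (ext u) (ext u) = 0.
    rewrite Bsum big1// => j _.
    by rewrite -extM uM0 mxE mulr0.
  move/eqP; rewrite psumr_eq0 => [|i _]; last exact/cell_ge0/rho_ge0.
  move/allP => z.
  have {}z i : (i < n)%N -> ext u i = 0 /\ ext u i.+1 = 0.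
    move=> ilt; have := z (Ordinal ilt); rewrite mem_index_enum => /(_ isT)/eqP/=.
    by apply: cell_eq0; exact: rho_ge0.
  apply/rowP => j; rewrite mxE.
  have -> : u ord0 j = ext u j by rewrite /ext inord_val.
  case: j => [[|j] /= jn]; first by have [] := z 0%N n0.
  by have [] := z j jn.
pose L : 'rV[R]_n.+1 := \row_j residual rho n s (fun=> 0) (unit_at j).
exists (ext (L *m invmx M)) => v.
rewrite residual_sumr big1// => j _.
by rewrite residualB -extM mulmxKV// mxE subrr mulr0.
Qed.


Lemma cell00 a b e e' : cell a b e e' 0 0 = 0.
Proof. by rewrite /cell !(mulr0, addr0). Qed.

Lemma residual_row0 rho n s x : residual rho n.+1 s x (unit_at 0) =
  cell (rho 0%N) (rho 1%N) (s 0%N - x 0%N) (s 0%N - x 1%N) 1 0.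
Proof.
rewrite /residual big_ord_recl/= big1 ?addr0// => i _.
by rewrite /unit_at/= cell00.
Qed.

Lemma residual_row rho n s x j : (j.+1 < n)%N -> residual rho n s x (unit_at j.+1) =
  cell (rho j) (rho j.+1) (s j - x j) (s j - x j.+1) 0 1 +
  cell (rho j.+1) (rho j.+2) (s j.+1 - x j.+1) (s j.+1 - x j.+2) 1 0.
Proof.
move=> jn; have jn' : (j < n)%N by exact: ltnW.
rewrite /residual (bigD1 (Ordinal jn'))//= (bigD1 (Ordinal jn))/=; last first.
  by rewrite -val_eqE/= neq_ltn ltnSn orbT.
rewrite {1 2 3 4}/unit_at !eqxx (ltn_eqF (ltnSn j)) (gtn_eqF (ltnSn j.+1)).
rewrite big1 ?addr0// => i; rewrite -!val_eqE/= => /andP[ij iSj].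
by rewrite /unit_at (negbTE iSj) eqSS (negbTE ij) cell00.
Qed.

Lemma residual_row_last rho n s x : residual rho n.+1 s x (unit_at n.+1) =
  cell (rho n) (rho n.+1) (s n - x n) (s n - x n.+1) 0 1.
Proof.
rewrite /residual big_ord_recr/= big1 ?add0r => [|i _]; last first.
  by rewrite /unit_at (ltn_eqF (ltnW _)) ?ltnS// eqSS (ltn_eqF _)// cell00.
by rewrite /unit_at (ltn_eqF (ltnSn _)) eqxx.
Qed.

(** The half-sides of the nested squares.  Consecutive positive ones have the
    ratio [K], and all errors will be of relative size [1 / K]. *)
Definition radius (K : R) i : R := if i is j.+1 then K ^+ j else 0.

(** The row of a level of radius [q], between levels of radii [r] and [K * q].
    The outer cell contributes [e3 + e4] with the coefficient
    [(K - 1) * K * q ^+ 2]; the remaining terms have coefficients of total size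
    at most [4 * K * q ^+ 2].  Dividing leaves the factor [4 / (K - 1)]. *)
Lemma row_estimate (K m e1 e2 e3 e4 r q : R) : 1 < K -> 0 < q -> 0 <= r < q ->
  `|e1| <= m -> `|e2| <= m -> `|e3| <= m -> `|e4| <= m ->
  cell r q e1 e2 0 1 + cell q (K * q) e3 e4 1 0 = 0 ->
  `|e3 + e4| <= 4 * m / (K - 1).
Proof.
move=> K1 q0 /andP[r0 rq] /[1!ler_norml]/andP[m1 m1'] /[1!ler_norml]/andP[m2 m2'].
move=> /[1!ler_norml]/andP[m3 m3'] /[1!ler_norml]/andP[m4 m4'] h.
have {}h : (K - 1) * q * (K * q) * (e3 + e4) =
  - ((q - r) * (q * (3 * e2 + e1) + r * (e1 + e2)) + (K - 1) * q * q * (3 * e3 + e4)).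
  by apply/eqP; rewrite -subr_eq0 -[X in _ == X]h /cell; apply/eqP; ring.
have m0 : 0 <= m by lra.
have q1 : 0 <= (q - r) * q by nra.
have q2 : 0 <= (q - r) * r by nra.
have q3 : 0 <= (K - 1) * q * q by apply: mulr_ge0; nra.
have c1 : `|(q - r) * q * (3 * e2 + e1)| <= (q - r) * q * (4 * m).
  by rewrite normrM ger0_norm// ler_wpM2l// ler_norml; lra.
have c2 : `|(q - r) * r * (e1 + e2)| <= (q - r) * r * (4 * m).
  by rewrite normrM ger0_norm// ler_wpM2l// ler_norml; lra.
have c3 : `|(K - 1) * q * q * (3 * e3 + e4)| <= (K - 1) * q * q * (4 * m).
  by rewrite normrM ger0_norm// ler_wpM2l// ler_norml; lra.
have p0 : 0 < (K - 1) * q * (K * q).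
  by rewrite !mulr_gt0//; lra.
suff : `|(K - 1) * q * (K * q) * (e3 + e4)| <= (K - 1) * q * (K * q) * (4 * m / (K - 1)).
  by rewrite normrM (gtr0_norm p0) (ler_pM2l p0).
rewrite h normrN mulrDr !mulrA.
apply: (@le_trans _ _ ((q - r) * q * (4 * m) + (q - r) * r * (4 * m) + (K - 1) * q * q * (4 * m))).
  apply: le_trans (ler_normD _ _) _; rewrite lerD//; apply: le_trans (ler_normD _ _) _.
  by rewrite lerD.
have -> : (K - 1) * q * K * q * 4 * m / (K - 1) = q * K * q * (4 * m).
  by field; lra.
rewrite -!mulrDl ler_wpM2r//; first by lra.
nra.
Qed.

(** In the outermost row there is no outer cell to dominate; of the inner one,
    the terms with the factor [r <= q / K] are negligible. *)
Lemma row_estimate_last (K m e3 e4 r q : R) : 1 < K -> 0 < q -> 0 <= r -> K * r <= q -> r < q ->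
  `|e3| <= m -> `|e4| <= m ->
  cell r q e3 e4 0 1 = 0 -> `|3 * e4 + e3| <= 4 * m / (K - 1).
Proof.
move=> K1 q0 r0 Krq rq m3 m4 /eqP.
have -> : cell r q e3 e4 0 1 = (q - r) * (q * (3 * e4 + e3) + r * (e3 + e4)).
  by rewrite /cell; ring.
rewrite mulf_eq0 subr_eq0 (gt_eqF rq)/= addr_eq0 => /eqP h.
have s34 : `|e3 + e4| <= 2 * m.
  by apply: le_trans (ler_normD _ _) _; lra.
have m0 : 0 <= m by apply: le_trans m3.
have qE : q * `|3 * e4 + e3| = r * `|e3 + e4|.
  by rewrite -{1}(gtr0_norm q0) -normrM h normrN normrM (ger0_norm r0).
have : (K - 1) * (q * `|3 * e4 + e3|) <= q * (2 * m).
  rewrite qE mulrA; apply: le_trans (_ : (K - 1) * r * (2 * m) <= _).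
    by rewrite ler_wpM2l// mulr_ge0//; lra.
  by rewrite ler_wpM2r; nra.
rewrite mulrCA ler_pM2l// => h2.
by rewrite ler_pdivlMr; nra.
Qed.

(** If all values were bounded by [2 * J], the errors in the rows would be
    bounded by [d].  The rows then say that [(-1) ^+ i * x i] is close to [-1]
    for [i = J + 1] and increases by about 2 with each step inwards.  The
    hypothesis on [K] keeps the accumulated error [(J + 2) * d] below 1. *)
Lemma residual_blowup J (K : R) x : 1 + 8 * (J.+2%:R) ^+ 2 <= K ->
  (forall v, residual (radius K) J.+1 (fun i => (-1) ^+ i) x v = 0) ->
  exists2 i, (i <= J.+1)%N & (2 * J)%:R < `|x i|.
Proof.
move=> KJ h; apply: contrapT => noi.
have xJ i : (i <= J.+1)%N -> `|x i| <= 2 * J%:R.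
  by move=> iJ; rewrite leNgt; apply/negP => hi; apply: noi; exists i; rewrite ?natrM.
have J0 : 0 <= J%:R :> R by [].
have JE : J.+2%:R = J%:R + 2 :> R by rewrite -addn2 natrD.
rewrite JE in KJ.
have K1 : 1 < K by nra.
have K0 : 0 < K by lra.
(* bound on the differences between the step function and the values [x i] *)
pose m : R := 2 * J%:R + 1.
pose s i : R := (-1) ^+ i.
have s1 i : `|s i| = 1 by rewrite normrX normrN1 expr1n.
have Em i j : (i <= J.+1)%N -> `|s j - x i| <= m.
  move=> iJ; apply: le_trans (ler_normB _ _) _.
  by rewrite s1 /m; have := xJ _ iJ; lra.
pose d : R := 4 * m / (K - 1).
have d0 : 0 <= d by rewrite /d divr_ge0// /m; lra.
have step i : (i <= J)%N -> `|(s i - x i) + (s i - x i.+1)| <= d.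
  case: i => [_|i iJ].
    have := h (unit_at 0); rewrite residual_row0 /radius/= expr0 /cell -/s.
    set e := s 0%N - _; set e' := s 0%N - _ => E.
    have -> : e + e' = 0 by rewrite -[RHS]E; ring.
    by rewrite normr0.
  have := h (unit_at i.+1); rewrite residual_row// -/s.
  have -> : radius K i.+2 = K * radius K i.+1 by rewrite /= exprS.
  apply: row_estimate => //.
  - by rewrite exprn_gt0.
  - case: i iJ => [|i] iJ; rewrite /= ?expr0 ?lexx ?ltr01//.
    by rewrite exprn_ge0 ?ltW//= ltr_eXn2l.
  - by apply: Em; lia.
  - by apply: Em; lia.
  - by apply: Em; lia.
  - by apply: Em; lia.
have last : `|3 * (s J - x J.+1) + (s J - x J)| <= d.
  have := h (unit_at J.+1); rewrite residual_row_last.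
  apply: row_estimate_last => //.
  - by rewrite /= exprn_gt0.
  - by case: J {KJ h noi xJ J0 JE m Em d d0 step} => //= i; rewrite exprn_ge0// ltW.
  - by case: J {KJ h noi xJ J0 JE m Em d d0 step} => [|i] /=; rewrite ?mulr0 ?expr0 -?exprS.
  - case: J {KJ h noi xJ J0 JE m Em d d0 step} => [|i] /=; rewrite ?expr0//.
    by rewrite ltr_eXn2l.
  - exact: Em.
  - exact: Em.
have sM i (u : R) : `|u| <= d -> - d <= s i * u <= d.
  by move=> ud; rewrite -ler_norml normrM s1 mul1r.
have ss i : s i * s i = 1 by rewrite -expr2 /s sqrr_sign.
have sS i : s i.+1 = - s i by rewrite /s exprS mulN1r.
have zlast : -1 - d <= s J.+1 * x J.+1.
  have := sM J _ last; have := sM J _ (step J (leqnn J)).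
  have -> : s J * (3 * (s J - x J.+1) + (s J - x J)) =
    3 * (s J * s J - s J * x J.+1) + (s J * s J - s J * x J) by ring.
  by rewrite !mulrDr !mulrN sS !ss !mulNr; lra.
have zstep i : (i <= J.+1)%N -> 2 * (J.+1 - i)%:R - 1 - (J.+2 - i)%:R * d <= s i * x i.
  move=> iJ; rewrite -(subKn iJ); move: (J.+1 - i)%N (leq_subr i J.+1) => k {i iJ}.
  elim: k => [|k IH] kJ.
    rewrite subn0 subnn (_ : J.+2 - J.+1 = 1)%N; last by lia.
    by move: zlast; lra.
  have {}IH := IH (ltnW kJ).
  have E : (J.+1 - k = (J.+1 - k.+1).+1)%N by lia.
  move: IH; rewrite !subKn// 1?ltnW// E.
  set i := (J.+1 - k.+1)%N => IH.
  have iJ : (i <= J)%N by rewrite /i; lia.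
  have := sM i _ (step i iJ); rewrite !mulrDr !mulrN !ss.
  move: IH; rewrite sS.
  have -> : (J.+2 - i.+1 = k.+1)%N by rewrite /i; lia.
  have -> : (J.+2 - i = k.+2)%N by rewrite /i; lia.
  rewrite -[k.+2]addn1 -[k.+1]addn1 !natrD.
  lra.
have := zstep 0%N isT; rewrite !subn0.
have : s 0%N * x 0%N <= 2 * J%:R.
  by rewrite /s expr0 mul1r; apply: le_trans (ler_norm _) _; exact: xJ.
rewrite JE -[J.+1]addn1 natrD /d /m.
have : (J%:R + 2) * (4 * (2 * J%:R + 1) / (K - 1)) < 1.
  rewrite mulrA ltr_pdivrMr; last by lra.
  by nra.
lra.
Qed.

End Discrete.

(** * Triangles in nested squares *)

Section Geometry.
Variable R : realType.
Implicit Types (a b c : R) (p q v w : R * R) (D : set (R * R)).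

Definition rot p : R * R := (- p.2, p.1).

Lemma rotK4 p : rot (rot (rot (rot p))) = p.
Proof. by case: p => x y; rewrite /rot /= !opprK. Qed.

Lemma rot_inj : injective rot.
Proof. by move=> p q pq; rewrite -[p]rotK4 pq rotK4. Qed.

Lemma rotD p q : rot (p + q) = rot p + rot q.
Proof. by case: p q => [x y] [z t]; rewrite /rot/= opprD. Qed.

Lemma rotZ a p : rot (a *: p) = a *: rot p.
Proof. by case: p => x y; rewrite /rot/=; congr pair; rewrite -[LHS]mulrN. Qed.

Lemma rot_triangle u v w : rot @` triangle u v w = triangle (rot u) (rot v) (rot w).
Proof.
apply/seteqP; split => [_ [_ [s [t [r [s0 t0 r0 str ->]]]] <-]|p].
  by exists s, t, r; rewrite !rotD !rotZ.
case=> s [t [r [s0 t0 r0 str ->]]]; exists (s *: u + t *: v + r *: w).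
  by exists s, t, r.
by rewrite !rotD !rotZ.
Qed.

Lemma rot_segment u v : rot @` segment u v = segment (rot u) (rot v).
Proof.
apply/seteqP; split => [_ [_ [t t01 ->] <-]|_ [t t01 ->]].
  by exists t => //; rewrite rotD !rotZ.
by exists ((1 - t) *: u + t *: v); [exists t|rewrite rotD !rotZ].
Qed.

Lemma rot_noncollinear u v w : noncollinear u v w -> noncollinear (rot u) (rot v) (rot w).
Proof.
by rewrite /noncollinear /rot/=; apply: contraNN => /eqP h; apply/eqP; rewrite -[RHS]h; ring.
Qed.

(** The condition on a pair of different triangles in [triangulation]. *)
Definition conform D D' :=
  [\/ D `&` D' = set0,
      exists v, [/\ is_vertex D v, is_vertex D' v & D `&` D' = [set v]] |
      is_edge D (D `&` D') /\ is_edge D' (D `&` D')].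

Lemma conform_sym D D' : conform D D' -> conform D' D.
Proof.
rewrite /conform (setIC D' D) => -[h|[a [h1 h2 h3]]|[h1 h2]].
- by constructor 1.
- by constructor 2; exists a.
- by constructor 3.
Qed.

Lemma rot_setI D D' : rot @` (D `&` D') = rot @` D `&` rot @` D'.
Proof.
apply/seteqP; split => [_ [p [Dp D'p] <-]|_ [[p Dp <-] [q D'q /rot_inj qp]]].
  by split; exists p.
by subst q; exists p.
Qed.

Lemma rot_vertex D v : is_vertex D v -> is_vertex (rot @` D) (rot v).
Proof.
case=> u [w [h ->]]; exists (rot u), (rot w).
by rewrite rot_triangle; split=> //; exact: rot_noncollinear.
Qed.

Lemma rot_edge D e : is_edge D e -> is_edge (rot @` D) (rot @` e).
Proof.
case=> u [v [w [h -> ->]]]; exists (rot u), (rot v), (rot w).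
by rewrite rot_triangle rot_segment; split=> //; exact: rot_noncollinear.
Qed.

Lemma conform_rot D D' : conform D D' -> conform (rot @` D) (rot @` D').
Proof.
rewrite /conform -rot_setI => -[->|[a [h1 h2 ->]]|[h1 h2]].
- by constructor 1; rewrite image_set0.
- constructor 2; exists (rot a); rewrite image_set1.
  by split=> //; exact: rot_vertex.
- by constructor 3; split; exact: rot_edge.
Qed.

Definition corner k b := iter k rot (b, - b).

Lemma corner4 k b : corner k.+4 b = corner k b.
Proof. exact: rotK4. Qed.

(** The two triangles of the trapezoid [k] between the squares of half-sides
    [a < b]: [ty] tells whether the side on a square lies on the outer one.
    They share the diagonal from [corner k a] to [corner k.+1 b]; its direction
    turns with [k], which makes the family invariant under [rot]. *)
Definition tile (ty : bool) k a b : set (R * R) :=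
  if ty then triangle (corner k b) (corner k.+1 b) (corner k a)
  else triangle (corner k a) (corner k.+1 a) (corner k.+1 b).

Lemma tileS ty k a b : tile ty k.+1 a b = rot @` tile ty k a b.
Proof. by case: ty; rewrite /tile rot_triangle. Qed.

Lemma tile4 ty k a b : tile ty k.+4 a b = tile ty k a b.
Proof. by rewrite /tile !corner4. Qed.

Lemma tile_rot ty k a b p : tile ty k.+1 a b (rot p) <-> tile ty k a b p.
Proof.
rewrite tileS; split; last by move=> h; exists p.
by case=> q h /rot_inj <-.
Qed.

(** For [a = 0] the trapezoid is a triangle, and its inner half degenerates. *)
Definition admissible (ty : bool) a b := [/\ 0 <= a, a < b & ty || (0 < a)].

(** Half-plane form of the tiles with [k = 0], so that intersections of tiles
    become questions about linear inequalities.  The last condition tells the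
    side of the diagonal. *)
Definition in_tile (ty : bool) a b p :=
  [/\ a <= p.1, p.1 <= b, - p.1 <= p.2, p.2 <= p.1 &
      if ty then (p.1 + p.2) * (b - a) <= 2 * (p.1 - a) * b
      else 2 * (p.1 - a) * b <= (p.1 + p.2) * (b - a)].

Lemma tile0P ty a b p : admissible ty a b -> tile ty 0 a b p <-> in_tile ty a b p.
Proof.
case=> a0 ab tya; have b0 : 0 < b by lra.
have ba : 0 < b - a by lra.
case: p => x y; case: ty tya => /= tya; split.
- case=> s [t [u [s0 t0 u0 stu]]]; rewrite /corner/= => -[-> ->].
  have -> : u = 1 - s - t by lra.
  have h1 : 0 <= s * b * (b - a) by rewrite !mulr_ge0//; lra.
  have h2 : 0 <= t * a * (b - a) by rewrite !mulr_ge0//; lra.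
  rewrite /in_tile /= /GRing.scale/=; split; nra.
- case=> /= ax xb yx1 yx2 h.
  (* barycentric coordinates: [r] measures the way from the inner to the outer side *)
  pose r := (x - a) / (b - a); pose t := (x + y) / (2 * b).
  have t0 : 0 <= t by rewrite /t divr_ge0//; lra.
  have tr : t <= r.
    rewrite /t /r ler_pdivrMr; last lra.
    rewrite mulrAC ler_pdivlMr//; lra.
  have r1 : r <= 1 by rewrite /r ler_pdivrMr//; lra.
  exists (r - t), t, (1 - r); split; [lra|lra|lra|lra|].
  rewrite /corner/= /GRing.scale/=; congr pair; rewrite /r /t/= /GRing.scale/=; field; lra.
- case=> s [t [u [s0 t0 u0 stu]]]; rewrite /corner/= => -[-> ->].
  have -> : u = 1 - s - t by lra.
  have h1 : 0 <= s * b * (b - a) by rewrite !mulr_ge0//; lra.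
  have h2 : 0 <= t * a * (b - a) by rewrite !mulr_ge0//; lra.
  rewrite /in_tile /= /GRing.scale/=; split; nra.
- case=> /= ax xb yx1 yx2 h.
  pose r := (x - a) / (b - a); pose t := (x - y) / (2 * a).
  have t0 : 0 <= t by rewrite /t divr_ge0//; lra.
  have r0 : 0 <= r by rewrite /r divr_ge0//; lra.
  have tr : t <= 1 - r.
    have -> : 1 - r = (b - x) / (b - a) by rewrite /r; field; lra.
    rewrite /t ler_pdivrMr; last lra.
    rewrite mulrAC ler_pdivlMr//; lra.
  exists t, (1 - r - t), r; split; [lra|lra|lra|lra|].
  rewrite /corner/= /GRing.scale/=; congr pair; rewrite /r /t/= /GRing.scale/=; field; lra.
Qed.


(** Four quarter turns are the identity, so [4 - m] of them undo [m]. *)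
Lemma tileP ty m a b p : (m <= 4)%N -> admissible ty a b ->
  tile ty m a b p <-> in_tile ty a b (iter (4 - m) rot p).
Proof.
move=> m4 adm; rewrite -tile0P//.
elim: m m4 p => [|m IH] m4 p; first by rewrite subn0 /= rotK4.
rewrite -[p in X in X <-> _]rotK4 tile_rot (IH (ltnW m4)).
have -> : (4 - m = (4 - m.+1).+1)%N by lia.
by rewrite iterSr rotK4.
Qed.

Lemma triangleC u v w : triangle u v w = triangle v w u.
Proof.
apply/seteqP; split => p [s [t [r [s0 t0 r0 str ->]]]].
- by exists t, r, s; split=> //; [lra|rewrite -addrA addrC].
- by exists r, s, t; split=> //; [lra|rewrite addrC addrA].
Qed.

Lemma noncollinearC u v w : noncollinear u v w -> noncollinear v w u.
Proof.
by rewrite /noncollinear; apply: contraNN => /eqP h; apply/eqP; rewrite -[RHS]h; ring.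
Qed.

Lemma segmentC u v : segment u v = segment v u.
Proof.
by apply/seteqP; split => p [t t01 ->]; exists (1 - t); rewrite ?subKr 1?addrC//; lra.
Qed.

Lemma triangle_faces u v w (T := triangle u v w) : noncollinear u v w ->
  [/\ is_vertex T u, is_vertex T v & is_vertex T w] /\
  [/\ is_edge T (segment u v), is_edge T (segment v w) & is_edge T (segment w u)].
Proof.
move=> h; have h' := noncollinearC h; have h'' := noncollinearC h'.
have e' : T = triangle v w u by rewrite /T triangleC.
have e'' : T = triangle w u v by rewrite e' triangleC.
split; split.
- by exists v, w.
- by exists w, u.
- by exists u, v.
- by exists u, v, w.
- by exists v, w, u.
- by exists w, u, v.
Qed.

Lemma tile_noncollinear ty k a b : admissible ty a b ->
  if ty then noncollinear (corner k b) (corner k.+1 b) (corner k a)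
  else noncollinear (corner k a) (corner k.+1 a) (corner k.+1 b).
Proof.
case=> a0 ab tya; elim: k => [|k].
  case: ty tya => /= tya; rewrite /noncollinear /corner/=.
    have -> : (- - b - b) * (- a - - b) - (b - - b) * (a - b) = 2 * b * (b - a) by ring.
    by rewrite !mulf_neq0//; lra.
  have -> : (- - a - a) * (b - - a) - (a - - a) * (- - b - a) = - (2 * a * (b - a)) by ring.
  by rewrite oppr_eq0 !mulf_neq0//; lra.
by case: ty tya => /= tya; exact: rot_noncollinear.
Qed.

Lemma conform_disjoint D D' : (forall p, D p -> D' p -> False) -> conform D D'.
Proof.
by move=> h; constructor 1; apply/seteqP; split => // p [/h].
Qed.

Lemma vertexW D v : is_vertex D v -> D v.
Proof.
case=> u [w [_ ->]]; exists 1, 0, 0; split=> //; first by rewrite !addr0.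
by rewrite scale1r !scale0r !addr0.
Qed.

Lemma conform_vertex D D' v : is_vertex D v -> is_vertex D' v ->
  (forall p, D p -> D' p -> p = v) -> conform D D'.
Proof.
move=> Dv D'v h; constructor 2; exists v; split=> //.
apply/seteqP; split => [p [/h /[apply]]//|_ ->].
by split; exact: vertexW.
Qed.

Lemma edgeW D e : is_edge D e -> e `<=` D.
Proof.
case=> u [v [w [_ -> ->]]] p [t /andP[t0 t1] ->].
exists (1 - t), t, 0; split=> //; [lra|lra|].
by rewrite scale0r addr0.
Qed.

Lemma conform_edge D D' e : is_edge D e -> is_edge D' e ->
  (forall p, D p -> D' p -> e p) -> conform D D'.
Proof.
move=> De D'e h; constructor 3.
suff -> : D `&` D' = e by [].
apply/seteqP; split => [p [/h /[apply]]//|p ep].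
by split; [exact: edgeW De _ ep|exact: edgeW D'e _ ep].
Qed.

(** Tiles in neighbouring trapezoids of one annulus can only meet on the ray
    [p.1 = p.2], where an outer tile of the lower trapezoid has its vertex
    [corner 1 b] only, and an inner tile of the upper one its vertex
    [corner 1 a] only.  For [a = 0] both tiles contain the whole segment from
    the origin to [corner 1 b]. *)
Lemma conform_same1 ty ty' a b : admissible ty a b -> admissible ty' a b ->
  conform (tile ty 0 a b) (tile ty' 1 a b).
Proof.
move=> adm adm'; have := tile_noncollinear 0 adm; have := tile_noncollinear 1 adm'.
have P p : tile ty 0 a b p -> tile ty' 1 a b p ->
    [/\ p.1 = p.2, a <= p.1 <= b, ty -> p.1 * a = a * b & ty' || (p.1 <= a)].
  rewrite !tileP// => -[/= h1 h2 h3 h4 h5] [/= g1 g2 g3 g4 g5].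
  have E : p.1 = p.2 by lra.
  case: adm => a0 ab tya.
  split; [by []|lra| |].
    by move=> tyT; rewrite tyT in h5; nra.
  by case: ty' {adm'} g5 => //=; nra.
case: adm adm' => a0 ab tya [_ _ tya'].
case: ty ty' tya tya' P => [] [] /= tya tya' P /triangle_faces[[v1 v2 v3] [e1 e2 e3]].
all: move=> /triangle_faces[[v1' v2' v3'] [e1' e2' e3']].
- have [az|az] := eqVneq a 0.
    apply: (conform_edge (e := segment (corner 1 b) (corner 0 a))) => //.
      have -> : corner 0 a = corner 1 a by rewrite /corner/= /rot/= az !oppr0.
      by rewrite segmentC.
    move=> [x y] Dp D'p; have [/= xy axb _ _] := P _ Dp D'p.
    exists ((b - x) / b); first by rewrite divr_ge0 ?ler_pdivrMr//=; lra.
    by rewrite /corner/= az /GRing.scale/=; congr pair; rewrite /= /GRing.scale/= -?xy; field; lra.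
  apply: (conform_vertex (v := corner 1 b)) => //.
  move=> [x y] Dp D'p; have [/= xy axb /(_ isT) xb _] := P _ Dp D'p.
  have {}xb : x = b by apply: (mulIf az); rewrite xb mulrC.
  by rewrite /corner/= /rot/= opprK -xy xb.
- apply: conform_disjoint => p Dp D'p; have [xy axb /(_ isT) xb xa] := P _ Dp D'p.
  have : p.1 = b by apply: (mulIf (_ : a != 0)); rewrite ?xb ?(mulrC b)//; lra.
  lra.
- apply: (conform_edge (e := segment (corner 1 a) (corner 1 b))) => //.
    move=> [x y] Dp D'p; have [/= xy axb _ _] := P _ Dp D'p.
    exists ((x - a) / (b - a)); first by rewrite divr_ge0 ?ler_pdivrMr//=; lra.
    by rewrite /corner/= /GRing.scale/=; congr pair; rewrite /= /GRing.scale/= -?xy; field; lra.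
- apply: (conform_vertex (v := corner 1 a)) => //.
  move=> [x y] Dp D'p; have [/= xy axb _ xa] := P _ Dp D'p.
  by rewrite /corner/= /rot/= opprK -xy; congr pair; lra.
Qed.

Lemma conform_iter_rot D D' k : conform D D' -> conform (iter k rot @` D) (iter k rot @` D').
Proof.
elim: k D D' => [|k IH] D D' h; first by rewrite !image_id.
by move/conform_rot/IH: h; rewrite !image_comp (_ : iter k rot \o rot = iter k.+1 rot)//;
  apply/funext => p; rewrite [LHS]/= -iterSr.
Qed.

(** The two tiles of a trapezoid share its diagonal. *)
Lemma conform_same0 a b : admissible false a b ->
  conform (tile true 0 a b) (tile false 0 a b).
Proof.
move=> adm; have admT : admissible true a b by case: adm.
have /triangle_faces[_ [e1 e2 e3]] := tile_noncollinear 0 admT.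
have /triangle_faces[_ [e1' e2' e3']] := tile_noncollinear 0 adm.
apply: (conform_edge (e := segment (corner 1 b) (corner 0 a))) => //.
move=> [x y]; rewrite !tile0P//; case: adm => a0 ab _ [/= h1 h2 h3 h4 h5] [/= _ _ _ _ h6].
have E : y = 2 * (x - a) * b / (b - a) - x.
  apply: (mulIf (_ : b - a != 0)); first lra.
  by rewrite mulrBl divfK//; lra.
exists ((b - x) / (b - a)); first by rewrite divr_ge0 ?ler_pdivrMr//=; lra.
rewrite /corner/= /GRing.scale/=; congr pair; rewrite /= /GRing.scale/= ?E; field; lra.
Qed.

Lemma conform_same ty ty' m a b : admissible ty a b -> admissible ty' a b ->
  (m < 4)%N -> (m != 0)%N || (ty != ty') ->
  conform (tile ty 0 a b) (tile ty' m a b).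
Proof.
move=> adm adm'; case: m => [|[|[|[|//]]]] _ /=.
- by case: ty ty' adm adm' => [] [] //= adm adm' _;
    [|apply: conform_sym]; exact: conform_same0.
- by move=> _; exact: conform_same1.
- move=> _; have := tile_noncollinear 0 adm; have := tile_noncollinear 2 adm'.
  have P p : tile ty 0 a b p -> tile ty' 2 a b p -> [/\ p.1 = 0, p.2 = 0 & a = 0].
    rewrite !tileP// => -[/= h1 h2 h3 h4 h5] [/= g1 g2 g3 g4 g5].
    case: adm => a0 ab tya; split; lra.
  have [az|az] := eqVneq a 0; last first.
    by move=> _ _; apply: conform_disjoint => p /P /[apply] -[_ _]; exact/eqP.
  case: adm adm' => a0 ab tya [_ _ tya'].
  have ty1 : ty = true by case: ty tya {P} => //=; lra.
  have ty1' : ty' = true by case: ty' tya' {P} => //=; lra.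
  subst ty ty'.
  move=> /triangle_faces[[_ _ v3'] _] /triangle_faces[[_ _ v3] _].
  apply: (conform_vertex (v := corner 0 a)) => //.
    have -> : corner 0 a = corner 2 a by rewrite /corner/= /rot/= az !oppr0.
    exact: v3'.
  by move=> [x y] Dp /(P _ Dp)/= [-> -> _]; rewrite /corner/= az oppr0.
- move=> _; apply: conform_sym.
  have := conform_iter_rot 3 (conform_same1 adm' adm).
  have iter3 E : iter 3 rot @` E = rot @` (rot @` (rot @` E)) by rewrite !image_comp.
  by rewrite !iter3 -!tileS tile4.
Qed.

(** Tiles of consecutive annuli can only meet on the square between them.  There
    each of the two has a side or a single vertex, and the cases differ by the
    positions of these on the square. *)
Lemma conform_next ty ty' m a b c : admissible ty a b -> admissible ty' b c ->
  (m < 4)%N -> conform (tile ty 0 a b) (tile ty' m b c).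
Proof.
move=> adm adm' m4; have m4' := ltnW m4.
have := tile_noncollinear 0 adm; have := tile_noncollinear m adm'.
have P p : tile ty 0 a b p -> tile ty' m b c p ->
    [/\ in_tile ty a b p & in_tile ty' b c (iter (4 - m) rot p)].
  by rewrite tile0P// tileP//.
case: (adm) (adm') => a0 ab tya [b0 bc tyb].
have ba0 : 0 < b - a by lra.
have cb0 : 0 < c - b by lra.
case: m m4 P {m4'} => [|[|[|[|//]]]] _.
- move=> P; case: ty ty' tya tyb P {adm adm'} => [] [] /= tya tyb P;
    move=> /triangle_faces[[v1 v2 v3] [e1 e2 e3]];
    move=> /triangle_faces[[v1' v2' v3'] [e1' e2' e3']].
  + apply: (conform_vertex (v := corner 0 b)) => //.
    move=> [x y] Dp /(P _ Dp)[[/= h1 h2 h3 h4 h5] [/= g1 g2 g3 g4 g5]].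
    by rewrite /corner/=; congr pair; nra.
  + apply: (conform_edge (e := segment (corner 0 b) (corner 1 b))) => //.
    move=> [x y] Dp /(P _ Dp)[[/= h1 h2 h3 h4 h5] [/= g1 g2 g3 g4 g5]].
    exists ((y + b) / (2 * b)); first by rewrite divr_ge0 ?ler_pdivrMr//=; lra.
    have -> : x = b by lra.
    by rewrite /corner/= /GRing.scale/=; congr pair; rewrite /= /GRing.scale/=; field; lra.
  + apply: conform_disjoint => [[x y]] Dp /(P _ Dp)[[/= h1 h2 h3 h4 h5] [/= g1 g2 g3 g4 g5]].
    have xb : x = b by lra.
 subst x.
    have : b <= y by rewrite -(ler_pM2r ba0); lra.
    have : y <= - b by rewrite -(ler_pM2r cb0); lra.
    lra.
  + apply: (conform_vertex (v := corner 1 b)) => //.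
    move=> [x y] Dp /(P _ Dp)[[/= h1 h2 h3 h4 h5] [/= g1 g2 g3 g4 g5]].
    have xb : x = b by lra.
    by subst x; rewrite /corner/= /rot/= opprK; congr pair; nra.
- move=> P.
  have {}P p : tile ty 0 a b p -> tile ty' 1 b c p -> p = corner 1 b.
    case: p => [x y] Dp /(P _ Dp)[[/= h1 h2 h3 h4 h5] [/= g1 g2 g3 g4 g5]].
    by rewrite /corner/= /rot/= opprK; congr pair; lra.
  case: ty ty' tya tyb P {adm adm'} => [] [] /= tya tyb P /triangle_faces[[v1 v2 v3] _];
    by move=> /triangle_faces[[v1' v2' v3'] _]; exact: (conform_vertex (v := corner 1 b)).
- move=> P _ _; apply: conform_disjoint => p Dp /(P _ Dp)[[/= h1 h2 h3 h4 h5] [/= g1 g2 g3 g4 g5]].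
  lra.
- move=> P.
  have {}P p : tile ty 0 a b p -> tile ty' 3 b c p -> [/\ p = corner 0 b, ty & ~~ ty'].
    case: p => [x y] Dp /(P _ Dp)[[/= h1 h2 h3 h4 h5] [/= g1 g2 g3 g4 g5]].
    have xb : x = b by lra.
    have yb : y = - b by lra.
    subst x y; split=> //.
      by case: ty h5 {P Dp adm tya} => //; nra.
    by case: ty' g5 {P adm' tyb} => //; nra.
  case: ty ty' tya tyb P {adm adm'} => [] [] /= tya tyb P;
    try by move=> _ _; apply: conform_disjoint => p /P /[apply] -[].
  move=> /triangle_faces[[v1 v2 v3] _] /triangle_faces[[v1' v2' v3'] _].
  apply: (conform_vertex (v := corner 0 b)) => [//||p /P /[apply] -[]//].
  by rewrite -(corner4 0 b); exact: v2.
Qed.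

Lemma conform_far ty ty' m a b c d : admissible ty a b -> admissible ty' c d ->
  b < c -> (m < 4)%N -> conform (tile ty 0 a b) (tile ty' m c d).
Proof.
move=> adm adm' bc m4; have m4' := ltnW m4.
apply: conform_disjoint => p; rewrite !tileP//; case: (adm) => a0 ab _.
by case: m m4 {m4'} => [|[|[|[|//]]]] _ [/= h1 h2 h3 h4 h5] [/= g1 g2 g3 g4 g5]; lra.
Qed.

Variable rho : nat -> R.
Hypothesis rho0 : rho 0%N = 0.
Hypothesis rhoS : forall i, rho i < rho i.+1.

Lemma rho_lt i j : (i < j)%N -> rho i < rho j.
Proof. by apply: (homo_ltn (r := fun x y : R => x < y)) => [y x z|//]; exact: lt_trans. Qed.

Lemma rho_ge0 i : 0 <= rho i.
Proof. by case: i => [|i]; rewrite -rho0// ltW// rho_lt. Qed.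

Lemma admissible_rho ty i : ty || (0 < i)%N -> admissible ty (rho i) (rho i.+1).
Proof.
move=> h; split; [exact: rho_ge0|exact: rhoS|].
by case/orP: h => [->//|i0]; rewrite -rho0 (rho_lt i0) orbT.
Qed.

Lemma conform_sector0 ty ty' m i j : ty || (0 < i)%N -> ty' || (0 < j)%N -> (m < 4)%N ->
  (i <= j)%N -> [|| i != j, m != 0%N | ty != ty'] ->
  conform (tile ty 0 (rho i) (rho i.+1)) (tile ty' m (rho j) (rho j.+1)).
Proof.
move=> hi hj m4; have ai := admissible_rho hi; have aj := admissible_rho hj.
rewrite leq_eqVlt => /predU1P[ij|].
  by subst j; rewrite eqxx/= => h; exact: conform_same.
rewrite leq_eqVlt => /predU1P[ij _|ij _]; first by subst j; exact: conform_next.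
by apply: conform_far => //; exact: rho_lt.
Qed.

Lemma tile_iter ty k m a b : tile ty (k + m) a b = iter k rot @` tile ty m a b.
Proof.
elim: k => [|k IH]; first by rewrite image_id.
by rewrite addSn tileS IH image_comp.
Qed.

Lemma tile_shift ty k k' a b : (k < 4)%N -> (k' < 4)%N ->
  exists m, [/\ (m < 4)%N, (m == 0%N) = (k == k') & tile ty k' a b = iter k rot @` tile ty m a b].
Proof.
move=> k4 k'4; exists ((k' + (4 - k)) %% 4)%N; split; first by rewrite ltn_mod.
  by move: k k' k4 k'4 => [|[|[|[|//]]]] [|[|[|[|//]]]].
rewrite -tile_iter.
by move: k k' k4 k'4 => [|[|[|[|//]]]] [|[|[|[|//]]]] _ _; rewrite ?tile4.
Qed.

(** Up to a rotation the first tile has [k = 0], and up to symmetry it does not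
    lie outside the second one. *)
Lemma conform_tiles ty ty' k k' i j : ty || (0 < i)%N -> ty' || (0 < j)%N ->
  (k < 4)%N -> (k' < 4)%N -> (ty, k, i) <> (ty', k', j) ->
  conform (tile ty k (rho i) (rho i.+1)) (tile ty' k' (rho j) (rho j.+1)).
Proof.
wlog ij : ty ty' k k' i j / (i <= j)%N.
  move=> W hi hj k4 k'4 ne; have [ij|ji] := leqP i j; first exact: W.
  by apply/conform_sym/W => // [|e]; [exact: ltnW|apply: ne].
move=> hi hj k4 k'4 ne; have [m [m4 mk ->]] := tile_shift ty' (rho j) (rho j.+1) k4 k'4.
rewrite -[k in tile ty k]addn0 tile_iter; apply: conform_iter_rot; apply: conform_sector0 => //.
rewrite mk; apply: contrapT => /negP; rewrite !negb_or !negbK => /and3P[/eqP ? /eqP ? /eqP ?].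
by apply: ne; congr (_, _, _).
Qed.

Lemma segment_noncollinear u v w : noncollinear u v w -> ~ segment u v w.
Proof.
move=> h [t _ E]; move: h; rewrite E /noncollinear/= => /eqP; apply.
by rewrite /GRing.scale/=; ring.
Qed.

(** A triangle is neither empty nor equal to one of its faces; hence conforming
    tiles are different, which is what counting the tiles takes. *)
Lemma conform_neq D D' : is_triangle D -> conform D D' -> D <> D'.
Proof.
move=> [u [v [w [h DE]]]] + E; rewrite -{}E /conform setIid.
have [[Du Dv _] _] := triangle_faces h.
rewrite -DE in Du Dv.
case=> [D0|[p [_ _ Dp]]|[[u' [v' [w' [h' DE' De]]]] _]].
- by have := vertexW Du; rewrite D0.
- have := vertexW Du; have := vertexW Dv; rewrite Dp /= => vp up.
  by move: h; rewrite /noncollinear vp up !subrr !mul0r subrr eqxx.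
- apply: (segment_noncollinear h'); rewrite -De DE'.
  by have [[_ _ /vertexW]] := triangle_faces h'.
Qed.

End Geometry.

(** * The triangulation of the square *)

Section Mesh.
Variable R : realType.
Local Notation rot := (@rot R).
Implicit Types (a b c r : R) (p q u v w : R * R) (D E : set (R * R)).

Lemma normE p : `|p| = Num.max `|p.1| `|p.2|.
Proof. exact: prod_normE. Qed.

(** The norm of [R * R] is the max norm. *)
Definition square r : set (R * R) := [set p | `|p| <= r].

Lemma norm_rot p : `|rot p| = `|p|.
Proof. by rewrite !normE /= normrN maxC. Qed.

Lemma norm_iter_rot k p : `|iter k rot p| = `|p|.
Proof. by elim: k => //= k <-; exact: norm_rot. Qed.

Lemma norm_sector p : - p.1 <= p.2 <= p.1 -> `|p| = p.1.
Proof.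
move=> h; rewrite normE; have p0 : 0 <= p.1 by lra.
by rewrite (ger0_norm p0); apply/max_idPl; rewrite ler_norml.
Qed.

Lemma sector p : exists k, (k < 4)%N /\ - (iter k rot p).1 <= (iter k rot p).2 <= (iter k rot p).1.
Proof.
case: p => x y; case: (lerP `|y| `|x|).
  have [x0|/ltW x0] := leP 0 x; rewrite ?(ger0_norm x0) ?(ler0_norm x0) ler_norml => h.
    by exists 0%N; split=> //=; lra.
  by exists 2%N; split=> //=; lra.
move=> /ltW; have [y0|/ltW y0] := leP 0 y; rewrite ?(ger0_norm y0) ?(ler0_norm y0) ler_norml => h.
  by exists 3%N; split=> //=; lra.
by exists 1%N; split=> //=; lra.
Qed.

Lemma square_isquare r : 0 < r -> is_square (square r).
Proof.
move=> r0; exists (- r, - r), (2 * r, 0); split.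
  by apply/eqP => -[/eqP]; rewrite mulf_eq0 pnatr_eq0/= gt_eqF.
apply/seteqP; split => [[x y]|_ [s [t [s01 t01 ->]]]]; rewrite /square/= normE ge_max !ler_norml/=.
  move=> /andP[hx hy]; exists ((x + r) / (2 * r)), ((y + r) / (2 * r)); split.
  - by rewrite divr_ge0 ?ler_pdivrMr//; lra.
  - by rewrite divr_ge0 ?ler_pdivrMr//; lra.
  - by rewrite /GRing.scale/= oppr0; congr pair; rewrite /= /GRing.scale/=; field; lra.
rewrite /GRing.scale/= oppr0 !mulr0; apply/andP; split; nra.
Qed.

Lemma square_closed_ball r : 0 < r -> square r = closed_ball (0 : R * R) r.
Proof.
move=> r0; rewrite closed_ballE//; apply/seteqP.
by split=> p; rewrite /square /closed_ball_/= sub0r normrN.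
Qed.

Lemma square_interior r : 0 < r -> (square r)° = ball (0 : R * R) r.
Proof. by move=> r0; rewrite square_closed_ball// interior_closed_ballE. Qed.

Lemma ball0E r p : ball (0 : R * R) r p <-> `|p| < r.
Proof. by rewrite -ball_normE /ball_/= sub0r normrN. Qed.

(** The ball is a union of segments from the origin. *)
Lemma connected_ball0 r : 0 < r -> connected (ball (0 : R * R) r).
Proof.
move=> r0.
have -> : ball (0 : R * R) r =
    \bigcup_(p in ball (0 : R * R) r) ((fun t : R => t *: p) @` `[0, 1]).
  apply/seteqP; split => [p bp|z [p /ball0E bp [t /=]]].
    by exists p => //; exists 1; rewrite /= ?scale1r// in_itv/= ler01 lexx.
  rewrite in_itv/= => /andP[t0 t1] <-; apply/ball0E.
  by rewrite normrZ ger0_norm// (le_lt_trans _ bp)// ler_piMl.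
apply: bigcup_connected => [|p bp].
  by exists 0 => p _; exists 0; rewrite /= ?scale0r// in_itv/= lexx ler01.
apply: connected_continuous_connected; first exact: segment_connected.
exact: (continuous_subspaceT (@scalel_continuous _ _ p)).
Qed.

Lemma square_polygonal r : 0 < r -> polygonal_domain (square r).
Proof.
move=> r0; split.
- exists r; split=> [|M]; first exact: num_real.
  by move=> rM p /= pr; apply: le_trans pr (ltW rM).
- by rewrite square_interior//; exists 0; apply/ball0E; rewrite normr0.
- by rewrite square_interior//; exact: connected_ball0.
- by rewrite square_interior// closure_ballE square_closed_ball.
- exists [seq (corner k r, corner k.+1 r) | k <- iota 0 4].
  rewrite square_interior//.
  (* the boundary is the sphere of the max norm; its points are turned to the side [p.1 = r] *)
  have -> : square r `\` ball (0 : R * R) r = [set p | `|p| = r].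
    apply/seteqP; split => [p [/= pr] bp|p /= pr].
      by apply/eqP; rewrite eq_le pr leNgt; apply/negP => /ball0E.
    by split; [rewrite /square/= pr|move/ball0E; rewrite pr ltxx].
  have segE : segment (corner 0 r) (corner 1 r) = [set p | p.1 = r /\ - r <= p.2 <= r].
    apply/seteqP; split => [_ [t t01 ->]|[x y]/= [-> yr]].
      by rewrite /corner/= /GRing.scale/= /GRing.scale/=; split; [ring|nra].
    exists ((y + r) / (2 * r)); first by rewrite divr_ge0 ?ler_pdivrMr//=; lra.
    by rewrite /corner/= /GRing.scale/=; congr pair; rewrite /= /GRing.scale/=; field; lra.
  have segR k p : (k <= 4)%N -> segment (corner k r) (corner k.+1 r) p <->
      segment (corner 0 r) (corner 1 r) (iter (4 - k) rot p).
    elim: k p => [|k IH] p k4; first by rewrite subn0 /= rotK4.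
    have -> : segment (corner k.+1 r) (corner k.+2 r) =
        rot @` segment (corner k r) (corner k.+1 r) by rewrite rot_segment.
    have E : (4 - k = (4 - k.+1).+1)%N by lia.
    split=> [[q /IH h <-]|h].
      by rewrite -iterSr -E; apply: h; exact: ltnW.
    exists (rot (rot (rot p))); last by rewrite rotK4.
    by apply/IH; [exact: ltnW|rewrite E iterSr rotK4].
  apply/seteqP; split => [p /= pr|p [e /mapP[k k4 ->]]].
    have [k [k4 h]] := sector p.
    have {}pr : (iter k rot p).1 = r by rewrite -(norm_sector h) norm_iter_rot.
    pose k' := ((4 - k) %% 4)%N.
    exists (corner k' r, corner k'.+1 r).
      suff : (corner k' r, corner k'.+1 r) \in
          [seq (corner k r, corner k.+1 r) | k <- iota 0 4] by [].
      by apply/mapP; exists k'; rewrite ?mem_iota ?ltn_mod.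
    apply/segR; first by rewrite ltnW// ltn_mod.
    have -> : iter (4 - k') rot p = iter k rot p.
      by case: k k4 @k' h pr => [|[|[|[|//]]]] _ k' _ _; rewrite /k'//= rotK4.
    by rewrite segE/= pr; split=> //; rewrite -pr.
  have {}k4 : (k <= 4)%N by move: k4; rewrite mem_iota/= => /ltnW.
  move/(segR _ _ k4); rewrite segE/= => -[E h].
  rewrite -(norm_iter_rot (4 - k)) -E; apply: norm_sector; rewrite E; lra.
Qed.

Variable rho : nat -> R.
Hypothesis rho0 : rho 0%N = 0.
Hypothesis rhoS : forall i, rho i < rho i.+1.
Let rho_lt := rho_lt rhoS.
Let rho_ge0 := rho_ge0 rho0 rhoS.
Let admissible_rho := admissible_rho rho0 rhoS.

Definition mesh n : set (set (R * R)) := [set D | exists ty k i,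
  [/\ (k < 4)%N, (i < n)%N, ty || (0 < i)%N & D = tile ty k (rho i) (rho i.+1)]].

Lemma tile_sector ty k a b p : (k < 4)%N -> admissible ty a b -> tile ty k a b p ->
  let q := iter (4 - k) rot p in - q.1 <= q.2 <= q.1 /\ a <= `|p| <= b.
Proof.
move=> k4 adm /(tileP _ (ltnW k4) adm)[h1 h2 h3 h4 _] q.
have h : - q.1 <= q.2 <= q.1 by rewrite h3 h4.
have qp : `|p| = q.1 by rewrite -(norm_sector h) norm_iter_rot.
by split=> //; rewrite qp; apply/andP.
Qed.

Lemma locate n r : 0 <= r <= rho n.+1 -> exists2 i, (i <= n)%N & rho i <= r <= rho i.+1.
Proof.
elim: n => [|n IH] /andP[r0 rn]; first by exists 0%N; rewrite // rho0 r0.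
have [h|/ltW h] := leP r (rho n.+1).
  by have [|i ni hi] := IH; [rewrite r0|exists i => //; exact: leqW].
by exists n.+1; rewrite // h.
Qed.

Lemma locate_tile n p : square (rho n.+1) p ->
  exists ty k i, [/\ (k < 4)%N, (i <= n)%N, ty || (0 < i)%N &
                     tile ty k (rho i) (rho i.+1) p].
Proof.
move=> pn; have [|i ni /andP[ip pi]] := @locate n `|p|; first by rewrite normr_ge0.
have [k [k4 h]] := sector p; pose k' := ((4 - k) %% 4)%N.
have k'4 : (k' < 4)%N by rewrite ltn_mod.
have kk : iter (4 - k') rot p = iter k rot p.
  by case: k k4 @k' k'4 h => [|[|[|[|//]]]] _ k' _ _; rewrite /k'//= rotK4.
have pE := norm_sector h; rewrite norm_iter_rot in pE.
set q := iter k rot p in kk h pE.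
have ri := rho_ge0 i; have rSi := rhoS i.
pose ty := (q.1 + q.2) * (rho i.+1 - rho i) <= 2 * (q.1 - rho i) * rho i.+1.
have tyi : ty || (0 < i)%N.
  case: (posnP i) => [i0|_]; last by rewrite orbT.
  rewrite i0 in ri rSi *; rewrite /ty i0 orbF rho0 !subr0 -mulrA [leRHS]mulrA ler_wpM2r//; lra.
exists ty, k', i; split=> //.
apply/tileP; rewrite ?(ltnW k'4)//; first exact: admissible_rho.
rewrite kk; split; [lra|lra|lra|lra|].
by case: ifPn => //; rewrite /ty -ltNge => /ltW.
Qed.

Lemma cover_mesh n : \bigcup_(D in mesh n.+1) D = square (rho n.+1).
Proof.
apply/seteqP; split => [p [_ [ty [k [i [k4 ni tyi ->]]]]]|p /locate_tile].
  move=> /(tile_sector k4 (admissible_rho tyi))/= [_ /andP[_ h]].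
  rewrite /square/= (le_trans h)//.
  move: ni; rewrite leq_eqVlt => /predU1P[[->]//|]; rewrite ltnS => ni.
  exact/ltW/rho_lt.
by case=> ty [k [i [k4 ni tyi h]]]; exists (tile ty k (rho i) (rho i.+1)) => //; exists ty, k, i.
Qed.

Lemma tile_is_triangle ty k a b : admissible ty a b -> is_triangle (tile ty k a b).
Proof.
move=> adm; have := tile_noncollinear k adm; case: ty adm => adm h.
- by exists (corner k b), (corner k.+1 b), (corner k a).
- by exists (corner k a), (corner k.+1 a), (corner k.+1 b).
Qed.

(** The tile number [N] has [k = N %% 4], and [N %/ 4 = 2 * i] for the outer tile
    and [2 * i - 1] for the inner tile of the annulus [i]; this leaves out the
    degenerate inner tiles of the annulus 0. *)
Lemma card_mesh n : (mesh n.+1 #= `I_(8 * n + 4))%card.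
Proof.
pose ty N := ~~ odd (N %/ 4); pose k N := (N %% 4)%N; pose i N := uphalf (N %/ 4).
have tyi N : ty N || (0 < i N)%N.
  by rewrite /ty /i; case: (N %/ 4)%N => // m; rewrite uphalfE/= orbC.
have k4 N : (k N < 4)%N by rewrite ltn_mod.
have -> : mesh n.+1 = (fun N => tile (ty N) (k N) (rho (i N)) (rho (i N).+1)) @` `I_(8 * n + 4).
  apply/seteqP; split => [_ [t [h [j [h4 jn tj ->]]]]|_ [N /= Nn <-]].
    pose m := (j.*2 - ~~ t)%N.
    have tm : ~~ odd m = t.
      by rewrite /m; case: (t) tj => /= tj; rewrite ?subn0 ?odd_double// oddB ?odd_double//; lia.
    have im : uphalf m = j.
      by rewrite /m; case: (t) tj => /= tj; rewrite ?subn0 uphalfE; lia.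
    exists (m * 4 + h)%N; first by rewrite /= /m; case: (t); lia.
    by rewrite /ty /k /i divnMDl// divn_small// addn0 tm im modnMDl modn_small.
  exists (ty N), (k N), (i N); split=> //.
  by rewrite /i; have := divn_eq N 4; have := uphalfE (N %/ 4); lia.
apply: inj_card_eq => N M _ _ E.
apply: contrapT => NM.
have ne : (ty N, k N, i N) <> (ty M, k M, i M).
  case=> /negb_inj tE kE iE; apply: NM; rewrite (divn_eq N 4) (divn_eq M 4) -/(k N) -/(k M) kE.
  by congr (_ * _ + _)%N; have := uphalfK (N %/ 4); rewrite tE -/(i N) iE uphalfK; lia.
have := conform_tiles rho0 rhoS (tyi N) (tyi M) (k4 N) (k4 M) ne.
by move/conform_neq; apply => //; exact/tile_is_triangle/admissible_rho.
Qed.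

Lemma mesh_triangulation n : triangulation (square (rho n.+1)) (mesh n.+1).
Proof.
split.
- by exists (8 * n + 4)%N; exact: card_mesh.
- by move=> _ [ty [k [i [_ _ /admissible_rho h ->]]]]; exact: tile_is_triangle.
- exact: cover_mesh.
- move=> _ _ [ty [k [i [k4 _ tyi ->]]]] [ty' [k' [i' [k'4 _ tyi' ->]]]] ne.
  by apply: conform_tiles => // -[e1 e2 e3]; apply: ne; rewrite e1 e2 e3.
Qed.

End Mesh.

(** * Radial functions and averages over quarter turns *)

Section Radial.
Variable R : realType.
Local Notation rot := (@rot R).
Implicit Types (a b c r : R) (p q u v w : R * R) (D E : set (R * R)).
Variable rho : nat -> R.
Hypothesis rho0 : rho 0%N = 0.
Hypothesis rhoS : forall i, rho i < rho i.+1.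
Let rho_lt := rho_lt rhoS.
Let admissible_rho := admissible_rho rho0 rhoS.

Definition clamp (t : R) : R := Num.min 1 (Num.max 0 t).

(** Piecewise linear interpolation of the values [x i] at the nodes [rho i],
    written as a sum of ramps: this makes the continuity visible. *)
Definition interp n (x : nat -> R) r : R :=
  x 0%N + \sum_(i < n) (x i.+1 - x i) * clamp ((r - rho i) / (rho i.+1 - rho i)).

Lemma rho_le i j : (i <= j)%N -> rho i <= rho j.
Proof. by rewrite leq_eqVlt => /predU1P[->//|/rho_lt/ltW]. Qed.

Lemma interpE n x i r : (i < n)%N -> rho i <= r <= rho i.+1 ->
  interp n x r = x i + (x i.+1 - x i) * ((r - rho i) / (rho i.+1 - rho i)).
Proof.
move=> ni /andP[ir ri]; rewrite /interp.
pose F j := (x j.+1 - x j) * clamp ((r - rho j) / (rho j.+1 - rho j)).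
have d0 j : 0 < rho j.+1 - rho j by rewrite subr_gt0.
have Flt j : (j < i)%N -> F j = x j.+1 - x j.
  move=> ji; rewrite /F /clamp; have h : 1 <= (r - rho j) / (rho j.+1 - rho j).
    by rewrite ler_pdivlMr// mul1r lerB// (le_trans (rho_le ji)).
  by rewrite max_r ?min_l ?mulr1//; lra.
have Fgt j : (i < j)%N -> F j = 0.
  move=> ji; rewrite /F /clamp; have h : (r - rho j) / (rho j.+1 - rho j) <= 0.
    by rewrite pmulr_lle0 ?invr_gt0// subr_le0 (le_trans ri)// rho_le.
  by rewrite max_l ?min_r ?mulr0//; lra.
have Fi : F i = (x i.+1 - x i) * ((r - rho i) / (rho i.+1 - rho i)).
  have h0 : 0 <= (r - rho i) / (rho i.+1 - rho i).
    by rewrite divr_ge0// ?subr_ge0// ltW.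
  have h1 : (r - rho i) / (rho i.+1 - rho i) <= 1.
    by rewrite ler_pdivrMr// mul1r lerB.
  by rewrite /F /clamp max_r ?min_r.
rewrite -(big_mkord xpredT F) (big_cat_nat (n := i)) ?(ltnW ni)//=.
rewrite (big_ltn ni) [X in _ + (_ + X)]big_nat_cond [X in _ + (_ + X)]big1 ?addr0; last first.
  by move=> j /andP[/andP[ij _] _]; exact: Fgt.
rewrite Fi addrA; congr +%R.
rewrite (eq_big_nat _ _ (F2 := fun j => x j.+1 - x j)) => [|j /andP[_ ji]]; last exact: Flt.
by rewrite telescope_sumr// addrC subrK.
Qed.

Lemma continuous_clamp : continuous clamp.
Proof.
have -> : clamp = (cst 1 : R -> R^o) \min ((cst 0 : R -> R^o) \max (id : R -> R^o)) by [].
move=> t; apply: continuous_min; first exact: cst_continuous.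
by apply: continuous_max; [exact: cst_continuous|by move=> ?].
Qed.

Lemma continuous_interp n x : continuous (interp n x).
Proof.
elim: n => [|n IH] r.
  have -> : interp 0 x = cst (x 0%N) by apply/funext => t; rewrite /interp big_ord0 addr0.
  exact: cst_continuous.
have -> : interp n.+1 x = interp n x \+
    (fun t => (x n.+1 - x n) * clamp ((t - rho n) / (rho n.+1 - rho n))).
  by apply/funext => t; rewrite /interp big_ord_recr/= addrA.
apply: cvgD; first exact: IH.
apply: cvgM; first exact: cvg_cst.
apply: (@continuous_comp _ _ _ (fun r : R => (r - rho n) / (rho n.+1 - rho n)) clamp).
  by apply: cvgM; [apply: cvgB; [exact: cvg_id|exact: cvg_cst]|exact: cvg_cst].
exact: continuous_clamp.
Qed.

Lemma norm_linear_on_tile ty k a b : (k < 4)%N -> admissible ty a b ->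
  exists l m : R, forall p, tile ty k a b p -> `|p| = l * p.1 + m * p.2.
Proof.
move=> k4 adm.
suff [l [m lm]] : exists l m : R, forall p, (iter (4 - k) rot p).1 = l * p.1 + m * p.2.
  exists l, m => p /(tile_sector k4 adm)/= [/norm_sector].
  by rewrite norm_iter_rot lm.
case: k k4 => [|[|[|[|//]]]] _.
- by exists 1, 0 => p /=; rewrite !opprK mul1r mul0r addr0.
- by exists 0, 1 => p /=; rewrite opprK mul1r mul0r add0r.
- by exists (-1), 0 => p /=; rewrite mulN1r mul0r addr0.
- by exists 0, (-1) => p /=; rewrite mulN1r mul0r add0r.
Qed.

Definition radial n x : R * R -> R :=
  (fun p => interp n x `|p|) \_ (square (rho n)).

Lemma radial_in n x p : square (rho n) p -> radial n x p = interp n x `|p|.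
Proof. by move=> ps; rewrite /radial patchT// inE. Qed.

Lemma radial_out n x p : ~ square (rho n) p -> radial n x p = 0.
Proof. by move=> ps; rewrite /radial patchN// inE; apply/negP; rewrite inE. Qed.

Lemma radial_pwlinear n x :
  pwlinear (square (rho n.+1)) (mesh rho n.+1) (radial n.+1 x).
Proof.
split.
- apply: (@subspace_eq_continuous _ _ _ (fun p : R * R => interp n.+1 x `|p|)).
    by move=> p /set_mem ps; exact/esym/radial_in.
  apply: continuous_subspaceT => p.
  apply: (@continuous_comp _ _ _ (fun p : R * R => `|p|) (interp n.+1 x)).
    exact: norm_continuous.
  exact: continuous_interp.
- move=> D nD; have [ty [k [i [k4 ni tyi DE]]]] := nD.
  have [l [m lm]] := norm_linear_on_tile k4 (admissible_rho tyi).
  pose d := (x i.+1 - x i) / (rho i.+1 - rho i).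
  exists (x i - d * rho i), (d * l), (d * m) => p Dp.
  rewrite radial_in; last first.
    by rewrite -cover_mesh//; exists D.
  rewrite DE in Dp; rewrite (@interpE _ _ i)//; last first.
    by case: (tile_sector k4 (admissible_rho tyi) Dp).
  rewrite (lm _ Dp) /d; field.
  by rewrite subr_eq0 gt_eqF.
- exact: radial_out.
Qed.

Definition average (phi : R * R -> R) i : R := (\sum_(m < 4) phi (corner m (rho i))) / 4.

Lemma sum_rot (phi : R * R -> R) k p :
  \sum_(m < 4) phi (iter m rot (iter k rot p)) = \sum_(m < 4) phi (iter m rot p).
Proof.
elim: k => // k <-; rewrite [LHS]big_ord_recr [RHS]big_ord_recl/= rotK4 addrC.
by congr +%R; apply: eq_bigr => m _; rewrite /bump/= -iterSr.
Qed.

Lemma mesh_tile n ty k i : (i < n)%N -> ty || (0 < i)%N ->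
  mesh rho n (tile ty k (rho i) (rho i.+1)).
Proof.
move=> ni tyi; exists ty, (k %% 4)%N, i; rewrite ltn_mod; split=> //.
rewrite {1}(divn_eq k 4); elim: (k %/ 4)%N => // m IH.
by rewrite mulSn -addnA -IH; exact: tile4.
Qed.

Lemma affine_triangle (phi : R * R -> R) u v w s t r :
  (exists k l m : R, forall p, triangle u v w p -> phi p = k + l * p.1 + m * p.2) ->
  0 <= s -> 0 <= t -> 0 <= r -> s + t + r = 1 ->
  phi (s *: u + t *: v + r *: w) = s * phi u + t * phi v + r * phi w.
Proof.
case=> k [l [m E]] s0 t0 r0 str.
rewrite !E; last first.
- by exists s, t, r.
- by exists 1, 0, 0; split=> //; rewrite ?addr0// scale1r !scale0r !addr0.
- by exists 0, 1, 0; split=> //; rewrite ?addr0 ?add0r// scale1r !scale0r add0r addr0.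
- by exists 0, 0, 1; split=> //; rewrite ?addr0 ?add0r// scale1r !scale0r !add0r.
by rewrite /= /GRing.scale/= -[k in LHS]mul1r -str; ring.
Qed.

Lemma iter_rotD k s t r u v w :
  iter k rot (s *: u + t *: v + r *: w) =
  s *: iter k rot u + t *: iter k rot v + r *: iter k rot w.
Proof. by elim: k => //= k ->; rewrite !rotD !rotZ. Qed.

(** The quarter turns carry the tile of a point to the tiles of its images and
    preserve barycentric coordinates, so the average of [phi] at a point is the
    barycentric combination of three level averages.  In each tile two of the
    three vertices are on one level; therefore the combination depends on the
    max norm only. *)
Lemma average_pwlinear n phi p :
  pwlinear (square (rho n.+1)) (mesh rho n.+1) phi -> square (rho n.+1) p ->
  \sum_(m < 4) phi (iter m rot p) = 4 * interp n.+1 (average phi) `|p|.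
Proof.
move=> [_ phiT _] /(locate_tile rho0 rhoS)[ty [k [i [k4 ni tyi]]]].
have adm := admissible_rho tyi.
rewrite -[in tile _ k](addn0 k) tile_iter => -[q h <-].
rewrite sum_rot norm_iter_rot.
have [_ qi] := tile_sector (isT : 0 < 4)%N adm h.
have qE : `|q| = q.1.
  by move: h; rewrite tile0P// => -[_ _ h1 h2 _]; rewrite norm_sector// h1 h2.
rewrite (interpE _ _ qi)//.
have avE j : 4 * average phi j = \sum_(m < 4) phi (corner m (rho j)).
  by rewrite mulrC divfK// pnatr_eq0.
have avS j : \sum_(m < 4) phi (corner m.+1 (rho j)) = 4 * average phi j.
  by rewrite avE -(sum_rot phi 1); apply: eq_bigr => m _; rewrite /corner/= -iterSr.
have d0 : rho i.+1 - rho i != 0 by rewrite subr_eq0 gt_eqF.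
case: ty tyi adm h => tyi adm [s [t [r [s0 t0 r0 str qstr]]]].
- have sumE : \sum_(m < 4) phi (iter m rot q) = \sum_(m < 4)
     (s * phi (corner m (rho i.+1)) + t * phi (corner m.+1 (rho i.+1)) + r * phi (corner m (rho i))).
    apply: eq_bigr => m _; rewrite qstr iter_rotD.
    rewrite [iter m rot (corner 1 _)](_ : _ = corner m.+1 (rho i.+1)); last first.
      by rewrite /corner/= -iterSr.
    apply: affine_triangle => //.
    by apply: phiT; apply: (@mesh_tile _ true m i).
  rewrite sumE !big_split/= -!mulr_sumr avS -!avE.
  rewrite qE qstr /corner/= /GRing.scale/= opprK.
  rewrite (_ : r = 1 - s - t); last by rewrite -str; ring.
  by field.
- have sumE : \sum_(m < 4) phi (iter m rot q) = \sum_(m < 4)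
     (s * phi (corner m (rho i)) + t * phi (corner m.+1 (rho i)) +
      r * phi (corner m.+1 (rho i.+1))).
    apply: eq_bigr => m _; rewrite qstr iter_rotD.
    rewrite [iter m rot (corner 1 _)](_ : _ = corner m.+1 (rho i)); last first.
      by rewrite /corner/= -iterSr.
    rewrite [iter m rot (corner 1 _)](_ : _ = corner m.+1 (rho i.+1)); last first.
      by rewrite /corner/= -iterSr.
    apply: affine_triangle => //.
    by apply: phiT; apply: (@mesh_tile _ false m i).
  rewrite sumE !big_split/= -!mulr_sumr !avS -!avE.
  rewrite qE qstr /corner/= /GRing.scale/= opprK.
  rewrite (_ : r = 1 - s - t); last by rewrite -str; ring.
  by field.
Qed.

End Radial.

(** * Invariance of the plane measure under quarter turns *)

Section Measure.
Variable R : realType.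
Local Notation rot := (@rot R).
Local Notation T2 := (measurableTypeR R * measurableTypeR R)%type.
Local Notation mu := (@lebesgue2 R).
Local Notation lam := (@lebesgue_measure R).

Lemma measurable_rot : measurable_fun [set: T2] (rot : T2 -> T2).
Proof.
apply: measurable_fun_pair; last exact: measurable_fst.
apply: measurableT_comp; [exact: oppr_measurable|exact: measurable_snd].
Qed.

Lemma measurable_iter_rot k : measurable_fun [set: T2] (iter k rot : T2 -> T2).
Proof.
elim: k => [|k IH]; first exact: measurable_id.
exact: (measurableT_comp measurable_rot IH).
Qed.

Lemma measurable_norm2 : measurable_fun [set: T2] (fun p : T2 => `|p : R * R|).
Proof.
have -> : (fun p : T2 => `|p : R * R|) = (Num.norm \o fst) \max (Num.norm \o snd).
  by apply/funext => p; rewrite normE.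
by apply: measurable_maxr; apply: measurableT_comp;
  [exact: normr_measurable|exact: measurable_fst|exact: normr_measurable|exact: measurable_snd].
Qed.

Lemma measurable_square r : measurable (square r : set T2).
Proof.
rewrite -[square r]setTI; apply: measurable_fun_le => //.
exact: measurable_norm2.
Qed.

Lemma square_setX r : square r = `[- r, r] `*` `[- r, r] :> set (R * R).
Proof.
apply/seteqP; split => -[x y]; rewrite /square/= normE ge_max !ler_norml !in_itv/=.
  by case/andP.
by case=> -> ->.
Qed.

Lemma lebesgue2_setX (A B : set (measurableTypeR R)) : measurable A -> measurable B ->
  mu (A `*` B) = (lam A * lam B)%E.
Proof. exact: product_measure1E. Qed.

Lemma square_measure r : 0 < r -> mu (square r) = (4 * r ^+ 2)%:E.
Proof.
move=> r0; rewrite square_setX lebesgue2_setX//.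
rewrite lebesgue_measure_itv /= lte_fin ifT; last by lra.
by rewrite -EFinB -EFinM; congr EFin; ring.
Qed.

(** A product measure is determined by its values on rectangles, and a quarter
    turn maps rectangles to rectangles. *)
Lemma lebesgue2_rot (A : set T2) : measurable A -> pushforward mu rot A = mu A.
Proof.
pose pmu := measure_function_pushforward__canonical__measure_function_Measure mu measurable_rot.
move=> mA; apply/esym; change (mu A = pmu A).
apply: (product_measure_unique (m' := pmu)) => // X Y mX mY.
rewrite /= /pushforward (_ : _ @^-1` _ = Y `*` (-%R @^-1` X)).
  rewrite lebesgue2_setX//; last first.
    by rewrite -[X in measurable X]setTI; exact: oppr_measurable.
  by rewrite -[in RHS](lebesgue_measureN mX) muleC.
by apply/seteqP; split => -[x y] [].
Qed.

Lemma integral_rot (f : R * R -> R) :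
  measurable_fun [set: T2] f -> mu.-integrable setT (EFin \o f) ->
  mu.-integrable setT (EFin \o (f \o rot)) ->
  (\int[mu]_p (f (rot p))%:E = \int[mu]_p (f p)%:E)%E.
Proof.
move=> mf fi fri.
pose pmu := measure_function_pushforward__canonical__measure_function_Measure mu measurable_rot.
transitivity (\int[pmu]_(p in [set: T2]) (f p)%:E)%E.
  apply/esym/(integral_pushforward measurable_rot) => //.
  exact/measurable_EFinP.
by apply: eq_measure_integral => //= A mA _; exact: lebesgue2_rot.
Qed.

End Measure.

(** * Measurability of piecewise linear functions *)

Section Integral.
Variable R : realType.
Local Notation rot := (@rot R).
Local Notation T2 := (measurableTypeR R * measurableTypeR R)%type.
Local Notation mu := (@lebesgue2 R).
Implicit Types (a b c r : R) (p q u v w : R * R) (D E : set (R * R)).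

Lemma measurable_le_set (f g : T2 -> R) : measurable_fun [set: T2] f ->
  measurable_fun [set: T2] g -> measurable [set p : T2 | f p <= g p].
Proof. by move=> mf mg; rewrite -[X in measurable X]setTI; exact: measurable_fun_le. Qed.

Lemma measurable_affine (k l m : R) :
  measurable_fun [set: T2] (fun p : T2 => k + l * p.1 + m * p.2).
Proof.
apply: measurable_funD; last first.
  by apply: measurable_funM; [exact: measurable_cst|exact: measurable_snd].
apply: measurable_funD; first exact: measurable_cst.
by apply: measurable_funM; [exact: measurable_cst|exact: measurable_fst].
Qed.

(** The tiles are preimages under a rotation of intersections of half-planes. *)
Lemma measurable_tile ty k a b : (k < 4)%N -> admissible ty a b ->
  measurable (tile ty k a b : set T2).
Proof.
move=> k4 adm.
have -> : tile ty k a b = iter (4 - k) rot @^-1` [set p | in_tile ty a b p].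
  by apply/seteqP; split => p /=; move/(tileP _ (ltnW k4) adm).
rewrite -[X in measurable X]setTI; apply: measurable_iter_rot => //.
have m1 : measurable_fun [set: T2] (fst : T2 -> R) := measurable_fst.
have m2 : measurable_fun [set: T2] (snd : T2 -> R) := measurable_snd.
have mN : measurable_fun [set: T2] (fun p : T2 => - p.1 : R).
  by apply: measurableT_comp; [exact: oppr_measurable|exact: measurable_fst].
have -> : [set p | in_tile ty a b p] =
  [set p | a <= p.1] `&` [set p | p.1 <= b] `&` [set p | - p.1 <= p.2] `&`
  [set p | p.2 <= p.1] `&` (if ty then
     [set p | 0 + (b - a) * p.1 + (b - a) * p.2 <= (- (2 * a * b)) + (2 * b) * p.1 + 0 * p.2]
   else [set p | (- (2 * a * b)) + (2 * b) * p.1 + 0 * p.2 <= 0 + (b - a) * p.1 + (b - a) * p.2]).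
  (* the two sides of the diagonal condition, as affine functions of the coordinates *)
  have e1 p : 0 + (b - a) * p.1 + (b - a) * p.2 = (p.1 + p.2) * (b - a) by ring.
  have e2 p : (- (2 * a * b)) + (2 * b) * p.1 + 0 * p.2 = 2 * (p.1 - a) * b by ring.
  rewrite /in_tile; case: ty {adm}; apply/seteqP; split => p /=; rewrite e1 e2.
  - by case.
  - by case=> -[[[]]].
  - by case.
  - by case=> -[[[]]].
apply: measurableI; last by case: ty {adm}; apply: measurable_le_set; exact: measurable_affine.
by apply: measurableI; [apply: measurableI; [apply: measurableI|]|];
  apply: measurable_le_set => //; exact: measurable_cst.
Qed.

Variable rho : nat -> R.
Hypothesis rho0 : rho 0%N = 0.
Hypothesis rhoS : forall i, rho i < rho i.+1.
Let admissible_rho := admissible_rho rho0 rhoS.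

(** Both properties hold on each of the finitely many triangles. *)
Lemma pwlinear_measurable_bounded n phi :
  pwlinear (square (rho n.+1)) (mesh rho n.+1) phi ->
  measurable_fun [set: T2] phi /\ exists M, forall p, `|phi p| <= M.
Proof.
move=> [_ phiT phi0].
suff [mphi [M phiM]] : measurable_fun (square (rho n.+1) : set T2) phi /\
    exists M, forall p, square (rho n.+1) p -> `|phi p| <= M.
  split; last first.
    exists (Num.max 0 M) => p; rewrite le_max.
    by have [/phiM ->|/phi0->] := pselect (square (rho n.+1) p);
      rewrite ?orbT// normr0 lexx.
  have -> : phi = phi \_ (square (rho n.+1)).
    apply/funext => p; rewrite patchE; case: ifPn => // /negP; rewrite inE.
    exact: phi0.
  exact/(measurable_restrictT (phi : T2 -> R) (measurable_square (rho n.+1))).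
have [_ _ coverT _] := mesh_triangulation rho0 rhoS n.
have [finT _ _ _] := mesh_triangulation rho0 rhoS n.
have inQ D : mesh rho n.+1 D -> D `<=` square (rho n.+1).
  by move=> TD p Dp; rewrite -coverT; exists D.
have mT D : mesh rho n.+1 D -> measurable (D : set T2).
  by case=> ty [k [i [k4 _ tyi ->]]]; apply: measurable_tile => //; exact: admissible_rho.
rewrite -{}coverT; have /finite_seqP[s sE] := finT.
rewrite sE in mT phiT inQ *; rewrite bigcup_seq big_seq.
pose P (S : set (R * R)) := [/\ measurable (S : set T2), measurable_fun (S : set T2) phi &
  exists M, forall p, S p -> `|phi p| <= M].
suff [] : P (\big[setU/set0]_(D <- s | D \in s) D) by [].
elim/big_ind : _ => [|A B [mA mfA [M MA]] [mB mfB [N NB]]|D sD].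
- by split; [exact: measurable0|exact: measurable_fun_set0|exists 0].
- split; [exact: measurableU|exact/measurable_funU|exists (Num.max M N)].
  by move=> p [/MA h|/NB h]; rewrite le_max h ?orbT.
- split; first exact: mT.
    have [k [l [m E]]] := phiT _ sD.
    apply: (@eq_measurable_fun _ _ _ _ _ (fun p : T2 => k + l * p.1 + m * p.2)).
      by move=> p /set_mem /E.
    exact: (measurable_funTS (measurable_affine k l m)).
  have [k [l [m E]]] := phiT _ sD.
  exists (`|k| + `|l| * rho n.+1 + `|m| * rho n.+1) => p Dp.
  rewrite (E _ Dp); have := inQ _ sD _ Dp; rewrite /square/= normE ge_max => /andP[p1 p2].
  apply: le_trans (ler_normD _ _) _; apply: lerD; last by rewrite normrM ler_wpM2l.
  by apply: le_trans (ler_normD _ _) _; apply: lerD => //; rewrite normrM ler_wpM2l.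
Qed.

(** Bounded measurable functions supported in a square: a class of integrable
    functions stable under rotations and bounded measurable factors. *)
Definition bm_supported r (f : R * R -> R) := [/\ measurable_fun [set: T2] f,
  exists M, forall p, `|f p| <= M & forall p, ~ square r p -> f p = 0].

Lemma bm_supported_integrable r f : 0 < r -> bm_supported r f ->
  mu.-integrable [set: T2] (EFin \o f).
Proof.
move=> r0 [mf [M fM] f0].
have fi : mu.-integrable (square r) (EFin \o f).
  apply: measurable_bounded_integrable => //.
  - exact: measurable_square.
  - by rewrite square_measure// ltry.
  - exact: measurable_funTS.
  - exists M; split; first exact: num_real.
    by move=> N MN p _ /=; apply: le_trans (ltW MN).
have := (integrable_mkcond (mu := mu) (EFin \o f) (measurable_square r)).1 fi.
congr (integrable mu _ _); apply/funext => p; rewrite patchE; case: ifPn => // /negP.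
by rewrite inE => /f0 /= ->.
Qed.

End Integral.

(** * Reduction of integrals to a sector *)

Section Sector.
Variable R : realType.
Local Notation rot := (@rot R).
Local Notation T2 := (measurableTypeR R * measurableTypeR R)%type.
Local Notation mu := (@lebesgue2 R).
Local Notation lam := (@lebesgue_measure R).
Implicit Types (a b c r : R) (p q u v w : R * R) (D E : set (R * R)).

(** Half open, so that of the four images of a point under the quarter turns
    exactly one is in the sector, unless the point is the origin. *)
Definition in_sector p := (- p.1 < p.2) && (p.2 <= p.1).

Lemma sum_in_sector p : p != 0 ->
  \sum_(m < 4) (in_sector (iter (4 - m) rot p))%:R = 1 :> R.
Proof.
case: p => x y p0; rewrite !big_ord_recl big_ord0 /= /in_sector /=.
rewrite !opprK !ltrN2 !lerN2 addr0 (ltrNr x y) (lerNr x y).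
case: (ltgtP y x) => yx; case: (ltgtP y (- x)) => yNx /=; rewrite ?(addr0, add0r)//.
have x0 : x = 0 by lra.
have y0 : y = 0 by lra.
by case/eqP: p0; rewrite x0 y0.
Qed.

Lemma measurable_in_sector : measurable_fun [set: T2] (fun p : T2 => (in_sector p)%:R : R).
Proof.
rewrite (_ : (fun p : T2 => _) =
    fun p : T2 => if in_sector p then cst 1 p else cst 0 p); last first.
  by apply/funext => p; case: in_sector.
apply: measurable_fun_ifT => //.
apply: measurable_and.
  apply: measurable_fun_ltr; last exact: measurable_snd.
  by apply: measurableT_comp; [exact: oppr_measurable|exact: measurable_fst].
by apply: measurable_fun_ler; [exact: measurable_snd|exact: measurable_fst].
Qed.

Lemma bm_supported_rot r f k : bm_supported r f -> bm_supported r (f \o iter k rot).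
Proof.
case=> mf [M fM] f0; split.
- by apply: measurableT_comp => //; exact: measurable_iter_rot.
- by exists M => p /=.
- by move=> p np; apply: f0; rewrite /square/= norm_iter_rot.
Qed.

Lemma bm_supported_mul r f g : bm_supported r f -> measurable_fun [set: T2] (g : R * R -> R) ->
  (exists M : R, forall p, `|g p| <= M) -> bm_supported r (fun p => g p * f p).
Proof.
case=> mf [M fM] f0 mg [N gN]; split.
- exact: measurable_funM.
- by exists (N * M) => p; rewrite normrM ler_pM.
- by move=> p /f0 ->; rewrite mulr0.
Qed.

Lemma integral_iter_rot r (f : R * R -> R) k : 0 < r -> bm_supported r f ->
  (\int[mu]_p (f (iter k rot p))%:E = \int[mu]_p (f p)%:E)%E.
Proof.
move=> r0 tf; elim: k => // k <-.
have [m1 _ _] := bm_supported_rot k tf.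
have := @integral_rot R (f \o iter k rot) m1 (bm_supported_integrable r0 (bm_supported_rot k tf))
  (bm_supported_integrable r0 (bm_supported_rot 1 (bm_supported_rot k tf))).
by move=> <-; apply: eq_integral => p _; rewrite /= -iterSr.
Qed.

(** The preimages of the sector under the quarter turns partition the plane
    without the origin, and each of them can be turned back to the sector. *)
Lemma integral_sector r (f : R * R -> R) : 0 < r -> bm_supported r f ->
  (\int[mu]_p (f p)%:E =
   \int[mu]_p ((in_sector p)%:R * \sum_(m < 4) f (iter m rot p))%:E)%E.
Proof.
move=> r0 tf.
have bsec : exists M : R, forall p, `|(in_sector p)%:R : R| <= M.
  by exists 1 => p; rewrite normr_nat lern1 leq_b1.
have tG m : bm_supported r (fun p => (in_sector p)%:R * f (iter m rot p)).
  exact: bm_supported_mul (bm_supported_rot m tf) measurable_in_sector bsec.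
have tH m : bm_supported r (fun p => (in_sector (iter (4 - m) rot p))%:R * f p).
  apply: bm_supported_mul => //.
    have h := measurableT_comp measurable_in_sector (@measurable_iter_rot R (4 - m)).
    exact: h.
  by exists 1 => p; rewrite normr_nat lern1 leq_b1.
(* the [m]-th summand over the first sector is the integral over the [(4 - m)]-th one *)
transitivity (\sum_(m < 4) \int[mu]_p ((in_sector p)%:R * f (iter m rot p))%:E)%E; last first.
  rewrite -integral_sum//; last by move=> m; exact: bm_supported_integrable r0 (tG m).
  by apply: eq_integral => p _; rewrite mulr_sumr -sumEFin.
transitivity (\sum_(m < 4) \int[mu]_p ((in_sector (iter (4 - m) rot p))%:R * f p)%:E)%E; last first.
  apply: eq_bigr => m _; rewrite -(integral_iter_rot (4 - m) r0 (tG m)).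
  apply: eq_integral => p _; congr (_ * f _)%:E.
  by rewrite -iterD subnKC ?(ltnW (ltn_ord m))//= rotK4.
rewrite -integral_sum//; last by move=> m; exact: bm_supported_integrable r0 (tH m).
apply: ae_eq_integral => //.
- by case: tf => mf _ _; exact/measurable_EFinP.
- rewrite (_ : (fun p => _) = EFin \o (fun p =>
      \sum_(m < 4) (in_sector (iter (4 - m) rot p))%:R * f p)).
    apply/measurable_EFinP; apply: measurable_sum => m; by case: (tH m).
  by apply/funext => p; rewrite /= sumEFin.
- exists [set 0 : R * R]; split.
  + rewrite (_ : [set 0] = [set 0] `*` [set 0])//; first exact: measurableX.
    by apply/seteqP; split => [_ ->|[x y] [/= -> ->]].
  + rewrite (_ : [set 0] = [set 0] `*` [set 0])//.
      by rewrite [LHS]lebesgue2_setX// lebesgue_measure_set1 mule0.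
    by apply/seteqP; split => [_ ->|[x y] [/= -> ->]].
  + move=> p /=; apply: contra_notP => /eqP p0 _.
    by rewrite sumEFin -mulr_suml sum_in_sector// mul1r.
Qed.

(** The slice of the sector above [x > 0] has length [2 * x]. *)
Lemma integral_sector_fubini r (K : R -> R) : 0 < r -> measurable_fun [set: R] K ->
  (exists M : R, forall x, `|K x| <= M) -> (forall x, r < x -> K x = 0) ->
  (\int[mu]_p ((in_sector p)%:R * K p.1)%:E =
   \int[lam]_(x in `]0%R, r]) (2 * x * K x)%:E)%E.
Proof.
move=> r0 mK [M KM] K0.
have tK : bm_supported r (fun p => (in_sector p)%:R * K p.1).
  split.
  - apply: measurable_funM; first exact: measurable_in_sector.
    by apply: measurableT_comp => //; exact: measurable_fst.
  - exists M => p; rewrite normrM normr_nat -[leRHS]mul1r ler_pM//.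
    by rewrite lern1 leq_b1.
  - move=> p np; case: (boolP (in_sector p)) => [/andP[h1 h2]|_]; last by rewrite mul0r.
    rewrite K0 ?mulr0// ltNge; apply/negP => pr; apply: np.
    by rewrite /square/= norm_sector// h2 andbT ltW.
have Fub := integral12_prod_meas1 (m1 := lam) (m2 := lam) (bm_supported_integrable r0 tK).
apply: (etrans (esym Fub)); rewrite [RHS]integral_mkcond.
apply: eq_integral => x _; rewrite /fubini_F patchE.
have secE : (fun y => ((in_sector (x, y))%:R * K x)%:E) =
    (fun y => (K x)%:E * (\1_(`]- x, x] : set R) y)%:E)%E.
  by apply/funext => y; rewrite /= -EFinM mulrC /indic mem_setE in_itv.
rewrite [in LHS]secE integralZl//; last first.
  by apply: integrable_indic_itv.
rewrite integral_indic// setIT.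
have lE : lam (`]- x, x] : set R) = (if (- x < x)%R then (2 * x)%:E else 0)%E.
  rewrite lebesgue_measure_itv/= lte_fin; case: ifP => // _.
  by rewrite -EFinB; congr EFin; ring.
transitivity ((K x)%:E * (if (- x < x)%R then (2 * x)%:E else 0))%E.
  by congr (_ * _)%E; exact: lE.
case: ifPn => xx; case: ifPn => [|x0].
- by rewrite -EFinM mulrC.
- rewrite K0 ?mul0e// ltNge; apply/negP => xr; move/negP: x0; apply.
  by rewrite inE/= in_itv/= xr andbT; lra.
- by rewrite inE/= in_itv/= => /andP[x0 _]; exfalso; lra.
- by rewrite mule0.
Qed.

End Sector.

(** * Inner products with radial functions *)

Section Cells.
Variable R : realType.
Local Notation rot := (@rot R).
Local Notation T2 := (measurableTypeR R * measurableTypeR R)%type.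
Local Notation mu := (@lebesgue2 R).
Local Notation lam := (@lebesgue_measure R).
Implicit Types (a b c r : R) (p q u v w : R * R) (D E : set (R * R)).

Lemma Rintegral_poly (p P : {poly R}) a b : a < b -> P^`() = p ->
  \int[lam]_(x in `]a, b]) p.[x] = P.[b] - P.[a].
Proof.
move=> ab Pp.
have cp : {within `[a, b], continuous (horner p)}.
  exact: continuous_subspaceT (@continuous_horner _ p).
rewrite /Rintegral integral_itv_obnd_cbnd; last first.
  apply/measurable_EFinP.
  exact: measurable_funTS (continuous_measurable_fun (@continuous_horner _ p)).
rewrite (continuous_FTC2 (F := horner P))//.
- split.
  + by move=> x _; exact: derivable_horner.
  + exact/cvg_at_right_filter/continuous_horner.
  + exact/cvg_at_left_filter/continuous_horner.
- by move=> x _; rewrite -derivE Pp.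
Qed.

Definition affine_on a b e e' r : R := e + (e' - e) * ((r - a) / (b - a)).

Lemma Rintegral_cell a b e e' y y' : a < b ->
  \int[lam]_(r in `]a, b]) (8 * r * affine_on a b e e' r * affine_on a b y y' r) =
  2 / 3 * cell a b e e' y y'.
Proof.
move=> ab.
have d0 : b - a != 0 by rewrite subr_eq0 gt_eqF.
pose e1 := (e' - e) / (b - a); pose e0 := e - e1 * a.
pose y1 := (y' - y) / (b - a); pose y0 := y - y1 * a.
(* an antiderivative of [8 * r * (e0 + e1 * r) * (y0 + y1 * r)] *)
pose P : {poly R} := (4 * e0 * y0) *: 'X^2 + (8 / 3 * (e0 * y1 + e1 * y0)) *: 'X^3 +
  (2 * e1 * y1) *: 'X^4.
rewrite (@eq_Rintegral _ _ _ lam _ (fun r => (P^`()).[r])); last first.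
  move=> r _; rewrite /P !(derivD, derivZ, derivXn) !(hornerE, hornerMn).
  rewrite /affine_on /e0 /y0 /e1 /y1 /=.
  by field.
rewrite (Rintegral_poly ab erefl) /P !hornerE /cell /e0 /y0 /e1 /y1 /=.
by field.
Qed.

Variable rho : nat -> R.
Hypothesis rho0 : rho 0%N = 0.
Hypothesis rhoS : forall i, rho i < rho i.+1.
Let rho_lt := rho_lt rhoS.
Let rho_ge0 := rho_ge0 rho0 rhoS.

Lemma clamp_norm (t : R) : `|clamp t| <= 1.
Proof.
rewrite ger0_norm /clamp; first by rewrite ge_min lexx.
by rewrite le_min ler01 le_max lexx.
Qed.

Lemma interp_bounded n x : exists M, forall r, `|interp rho n x r| <= M.
Proof.
exists (`|x 0%N| + \sum_(i < n) `|x i.+1 - x i|) => r.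
apply: le_trans (ler_normD _ _) _; rewrite lerD2l.
apply: le_trans (ler_norm_sum _ _ _) _; apply: ler_sum => i _.
by rewrite normrM ler_piMr// clamp_norm.
Qed.

Lemma measurable_interp n x : measurable_fun [set: R] (interp rho n x).
Proof. exact: continuous_measurable_fun (@continuous_interp _ rho n x). Qed.

(** A radial weight does not see the difference between [phi] and its average
    over the quarter turns, and the latter is radial.  The four sectors of
    slice length [2 * r] make the factor [8 * r]. *)
Lemma inner_radial n (eta : R -> R) phi :
  measurable_fun [set: R] eta -> (exists M, forall r, `|eta r| <= M) ->
  pwlinear (square (rho n.+1)) (mesh rho n.+1) phi ->
  inner (square (rho n.+1)) (fun p => eta `|p|) phi =
  \int[lam]_(r in `]0, rho n.+1]) (8 * r * eta r * interp rho n.+1 (average rho phi) r).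
Proof.
move=> meta [M etaM] phiV; have [mphi [N phiN]] := pwlinear_measurable_bounded rho0 rhoS phiV.
have [_ _ phi0] := phiV.
have r0 : 0 < rho n.+1 by rewrite -[X in X < _]rho0 rho_lt.
set r := rho n.+1 in phiV phi0 r0 *; set X := interp _ _ _.
have tf : bm_supported r (fun p => eta `|p| * phi p).
  apply: bm_supported_mul.
  - by split=> //; exists N.
  - have h := measurableT_comp meta (@measurable_norm2 R).
    exact: h.
  - by exists M => p.
pose K x := if x <= r then 4 * eta x * X x else 0.
have mK : measurable_fun [set: R] K.
  apply: measurable_fun_ifT => //; first exact: measurable_fun_ler.
  apply: measurable_funM; last exact: measurable_interp.
  by apply: measurable_funM.
have bK : exists M, forall x, `|K x| <= M.
  have [B XB] := interp_bounded n.+1 (average rho phi).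
  exists (4 * M * B) => x; rewrite /K; case: ifPn => _.
    by rewrite !normrM !ler_pM// ?mulr_ge0// ger0_norm.
  have M0 : 0 <= M := le_trans (normr_ge0 _) (etaM 0).
  have B0 : 0 <= B := le_trans (normr_ge0 _) (XB 0).
  by rewrite normr0 !mulr_ge0.
rewrite /inner /Rintegral; congr fine.
transitivity (\int[mu]_p (eta `|p| * phi p)%:E)%E.
  rewrite [LHS]integral_mkcond; apply: eq_integral => p _; rewrite patchE.
  by case: ifPn => // /negP; rewrite inE => /phi0 ->; rewrite mulr0.
rewrite (integral_sector r0 tf).
transitivity (\int[mu]_p ((in_sector p)%:R * K p.1)%:E)%E.
  apply: eq_integral => p _; congr EFin.
  case: (boolP (in_sector p)) => [/andP[h1 h2]|_]; last by rewrite !mul0r.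
  have pE : `|p| = p.1 by rewrite norm_sector// h2 andbT ltW.
  rewrite !mul1r; under eq_bigr do rewrite norm_iter_rot.
  rewrite -mulr_sumr /K -pE; case: ifPn => pr.
    by rewrite (average_pwlinear rho0 rhoS phiV pr) /X; ring.
  rewrite big1 ?mulr0// => m _; apply: phi0.
  by rewrite /square/= norm_iter_rot; exact/negP.
rewrite (integral_sector_fubini r0 mK bK); last first.
  by move=> x rx; rewrite /K leNgt rx.
apply: eq_integral => x; rewrite inE/= in_itv/= => /andP[_ xr].
by rewrite /K xr; congr EFin; ring.
Qed.

Lemma Rintegral_cells n (g : R -> R) : lam.-integrable `]0, rho n] (EFin \o g) ->
  \int[lam]_(r in `]0, rho n]) g r = \sum_(i < n) \int[lam]_(r in `]rho i, rho i.+1]) g r.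
Proof.
elim: n => [|n IH] gi.
  by rewrite big_ord0 rho0 set_itvoc0 Rintegral_set0.
have h0 : (BRight 0 <= BRight (rho n))%O by rewrite bnd_simp.
have h1 : (BRight (rho n) <= BRight (rho n.+1))%O by rewrite bnd_simp ltW.
rewrite big_ord_recr/= -IH; last first.
  apply: integrableS gi => //; apply: subset_itvl; exact: h1.
by rewrite -(Rintegral_itvB gi h0 h1) addrC subrK.
Qed.

(** On each annulus the weight [eta] is affine in the max norm, so the integral
    of [inner_radial] is a sum of cells. *)
Lemma inner_residual n s x (eta : R -> R) phi :
  measurable_fun [set: R] eta -> (exists M, forall r, `|eta r| <= M) ->
  (forall i r, (i <= n)%N -> rho i < r <= rho i.+1 -> eta r = s i - interp rho n.+1 x r) ->
  pwlinear (square (rho n.+1)) (mesh rho n.+1) phi ->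
  inner (square (rho n.+1)) (fun p => eta `|p|) phi =
  2 / 3 * residual rho n.+1 s x (average rho phi).
Proof.
move=> meta [M etaM] etaE phiV.
rewrite inner_radial//; last by exists M.
rewrite Rintegral_cells; last first.
  have [B XB] := interp_bounded n.+1 (average rho phi).
  apply: measurable_bounded_integrable => //.
  - have : (lam (`]0%R, rho n.+1] : set R) < +oo)%E.
      by rewrite lebesgue_measure_itv/= lte_fin; case: ifP => // _; rewrite -EFinB ltry.
    by [].
  - apply: measurable_funTS; apply: measurable_funM; last exact: measurable_interp.
    by apply: measurable_funM => //; apply: measurable_funM.
  - exists (8 * rho n.+1 * M * B); split; first exact: num_real.
    move=> N MN r /=; rewrite in_itv/= => /andP[r0 rn]; apply: le_trans (ltW MN).
    rewrite !normrM (ger0_norm (ltW r0)) (ger0_norm (ler0n _ 8)).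
    by rewrite !ler_pM// ?mulr_ge0// ltW.
rewrite /residual mulr_sumr; apply: eq_bigr => i _.
rewrite -Rintegral_cell//; apply: eq_Rintegral => r; rewrite inE/= in_itv/= => /andP[ir ri].
have iE : rho i <= r <= rho i.+1 by rewrite (ltW ir).
have itE : rho i < r <= rho i.+1 by rewrite ir.
rewrite (etaE i r (ltn_ord i) itE).
by rewrite !(interpE rhoS _ (ltn_ord i) iE) /affine_on; ring.
Qed.

End Cells.

(** * The projection of an alternating step function *)

Section Final.
Variable R : realType.
Local Notation rot := (@rot R).
Local Notation T2 := (measurableTypeR R * measurableTypeR R)%type.
Local Notation mu := (@lebesgue2 R).
Local Notation lam := (@lebesgue_measure R).
Implicit Types (a b c r : R) (p q u v w : R * R) (D E : set (R * R)).

Lemma measureT_gt0 : (0 < mu [set: T2])%E.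
Proof.
apply: (@lt_le_trans _ _ (mu (square 1))).
  by rewrite square_measure// lte_fin; lra.
apply: le_measure => //; rewrite inE//; exact: measurable_square.
Qed.

Lemma normLinfP D (f : R * R -> R) (y : \bar R) :
  (normLinf D f <= y)%E <-> {ae mu, forall p, (`|(f \_ D) p|%:E <= y)%E}.
Proof.
rewrite /normLinf unlock measureT_gt0.
by split => /ess_supP.
Qed.

Lemma closed_ball_setX q r : closed_ball_ Num.norm q r =
  `[q.1 - r, q.1 + r] `*` `[q.2 - r, q.2 + r].
Proof.
apply/seteqP; split => -[x y]; rewrite /closed_ball_/= normE/= ge_max !ler_norml !in_itv/=.
  by move=> /andP[h1 h2]; split; lra.
by move=> [h1 h2]; apply/andP; split; lra.
Qed.

Lemma closed_ball_measure q r : 0 < r -> mu (closed_ball_ Num.norm q r) = (4 * r ^+ 2)%:E.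
Proof.
move=> r0; rewrite closed_ball_setX lebesgue2_setX//.
have lE (u : R) : lam (`[u - r, u + r] : set R) = (2 * r)%:E.
  rewrite lebesgue_measure_itv/= lte_fin ifT; last by lra.
  by rewrite -EFinB; congr EFin; ring.
by rewrite !lE -EFinM; congr EFin; ring.
Qed.

(** A violation of the bound at [p] extends to the points of the square near
    [p].  They contain a ball even if [p] is on the boundary: the ball of radius
    [t * r] around [(1 - t) *: p] lies in the square. *)
Lemma ae_le_square r (g : R * R -> R) M : 0 < r -> {within square r, continuous g} ->
  (normLinf (square r) g <= M%:E)%E -> forall p, square r p -> `|g p| <= M.
Proof.
move=> r0 /subspace_continuousP gc /normLinfP[N [mN N0 NM]] p pr.
rewrite leNgt; apply/negP => Mg.
have : \forall q \near within (square r) (nbhs p), M < `|g q|.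
  exact: (cvgr_gt _ (cvg_norm (gc p pr)) _ Mg).
rewrite /within/= => /nbhs_ballP[e /= e0 pe].
have [t [t0 t1 te]] : exists t : R, [/\ 0 < t, t <= 1 & t * (2 * r) < e].
  exists (Num.min 1 (e / (4 * r))); split.
  - by rewrite lt_min ltr01 divr_gt0//; lra.
  - by rewrite ge_min lexx.
  - apply: (@le_lt_trans _ _ (e / (4 * r) * (2 * r))).
      by rewrite ler_wpM2r ?ge_min ?lexx ?orbT//; lra.
    have -> : e / (4 * r) * (2 * r) = e / 2 by field; lra.
    lra.
have : mu (closed_ball_ Num.norm ((1 - t) *: p) (t * r)) = 0.
  apply: (subset_measure0 _ mN _ N0).
    by rewrite closed_ball_setX; apply: measurableX.
  move=> q /= qt; apply: NM => /=.
  have h1 : `|(1 - t) *: p| <= (1 - t) * r.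
    by rewrite normrZ ger0_norm ?subr_ge0// ler_wpM2l// subr_ge0.
  have qr : square r q.
    rewrite /square/= -[q](subrK ((1 - t) *: p)) addrC.
    apply: le_trans (ler_normD _ _) _; rewrite distrC.
    by apply: le_trans (lerD h1 qt) _; rewrite -mulrDl subrK mul1r.
  rewrite patchT ?inE// lee_fin leNgt.
  have /pe/(_ qr) Mq : ball p e q.
    rewrite -ball_normE/= -(subrK ((1 - t) *: p) p) -addrA.
    apply: le_lt_trans (ler_normD _ _) _.
    have -> : p - (1 - t) *: p = t *: p by rewrite scalerBl scale1r subKr.
    rewrite normrZ (gtr0_norm t0).
    apply: le_lt_trans te; apply: (@le_trans _ _ (t * r + t * r)); last by lra.
    by apply: lerD => //; rewrite ler_wpM2l// ltW.
  by rewrite Mq.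
rewrite closed_ball_measure ?mulr_gt0// => /eqP.
by rewrite eqe mulf_eq0 expf_eq0/= pnatr_eq0/= gt_eqF// mulr_gt0.
Qed.

Lemma normLinf_sign r (f : R * R -> R) : 0 < r -> (forall p, `|f p| = 1) ->
  normLinf (square r) f = 1%E.
Proof.
move=> r0 f1; apply/eqP; rewrite eq_le; apply/andP; split.
  apply/normLinfP; apply: aeW => p; rewrite lee_fin patchE.
  by case: ifP => _; rewrite ?f1 ?normr0.
rewrite leNgt; apply/negP => h.
have [N [mN N0 NM]] := (normLinfP (square r) f _).1 (lexx _).
have : mu (square r) = 0.
  apply: (subset_measure0 (measurable_square r) mN _ N0) => p pr; apply: NM => /=.
  by rewrite patchT ?inE// f1 => /le_lt_trans/(_ h); rewrite ltxx.
by rewrite square_measure// => /eqP; rewrite eqe mulf_eq0 expf_eq0/= pnatr_eq0/= gt_eqF.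
Qed.

Variable rho : nat -> R.
Hypothesis rho0 : rho 0%N = 0.
Hypothesis rhoS : forall i, rho i < rho i.+1.
Let rho_lt := rho_lt rhoS.
Let rho_le := rho_le rhoS.
Let rho_ge0 := rho_ge0 rho0 rhoS.

(** The sign changes at each of the radii [rho 1, ..., rho n]. *)
Definition alternating n r : R := \prod_(1 <= i < n.+1) (if rho i < r then -1 else 1).

Lemma alternating_norm n r : `|alternating n r| = 1.
Proof.
rewrite /alternating normr_prod big1// => i _.
by case: ifP; rewrite ?normrN normr1.
Qed.

Lemma alternatingE n i r : (i <= n)%N -> rho i < r <= rho i.+1 ->
  alternating n r = (-1) ^+ i.
Proof.
move=> ni /andP[ir ri]; rewrite /alternating (big_cat_nat (n := i.+1))//=.
rewrite (eq_big_nat _ _ (F2 := fun=> -1)) => [|j /andP[_ ji]]; last first.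
  by rewrite (le_lt_trans (rho_le _) ir).
rewrite prodr_const_nat subn1 /= [X in _ * X]big_nat_cond big1 ?mulr1// => j /andP[/andP[ij _] _].
by rewrite ltNge (le_trans ri (rho_le ij)).
Qed.

Lemma measurable_alternating n : measurable_fun [set: R] (alternating n).
Proof.
rewrite /alternating; elim: n => [|n IH].
  by under eq_fun do rewrite big_geq//; exact: measurable_cst.
under eq_fun do rewrite big_nat_recr//=.
apply: measurable_funM => //; apply: measurable_fun_ifT => //.
exact: measurable_fun_ltr.
Qed.


Lemma eq_inner D (h h' phi phi' : R * R -> R) :
  (forall p, D p -> h p * phi p = h' p * phi' p) -> inner D h phi = inner D h' phi'.
Proof. by move=> e; apply: eq_Rintegral => p /set_mem /e. Qed.

Lemma innerB r (f g phi : R * R -> R) : 0 < r ->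
  bm_supported r (fun p => f p * phi p) -> bm_supported r (fun p => g p * phi p) ->
  inner (square r) (f \- g) phi = inner (square r) f phi - inner (square r) g phi.
Proof.
move=> r0 tf tg; rewrite /inner -RintegralB//.
- by apply: eq_Rintegral => p _; rewrite mulrBl.
- exact: measurable_square.
- exact: integrableS (measurable_square r) _ (bm_supported_integrable r0 tf).
- exact: integrableS (measurable_square r) _ (bm_supported_integrable r0 tg).
Qed.

Lemma rho_gt0 n : 0 < rho n.+1.
Proof. by rewrite -[X in X < _]rho0 rho_lt. Qed.

Lemma norm_corner k r : 0 <= r -> `|corner k r : R * R| = r.
Proof. by move=> r0; rewrite norm_iter_rot normE/= normrN maxxx ger0_norm. Qed.

Lemma average_radial n x i : (i <= n.+1)%N -> average rho (radial rho n.+1 x) i = x i.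
Proof.
move=> ni; rewrite /average.
have E : forall m : 'I_4, radial rho n.+1 x (corner m (rho i)) = x i.
  move=> m; rewrite radial_in ?norm_corner//; last first.
    by rewrite /square/= norm_corner// rho_le.
  case: i ni => [|i] ni.
    rewrite (interpE rhoS _ (isT : (0 < n.+1)%N)); last by rewrite lexx ltW.
    by rewrite subrr mul0r mulr0 addr0.
  rewrite (interpE rhoS _ ni); last by rewrite lexx ltW.
  by rewrite divff ?subr_eq0 ?gt_eqF// mulr1 addrC subrK.
rewrite (eq_bigr _ (fun m _ => E m)) sumr_const card_ord -[x i *+ 4]mulr_natr mulfK//.
Qed.

Lemma interp0 n r : interp rho n (fun=> 0) r = 0.
Proof. by rewrite /interp big1 ?addr0// => i _; rewrite subrr mul0r. Qed.

Lemma interpN n x r : interp rho n (fun i => - x i) r = - interp rho n x r.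
Proof.
rewrite /interp opprD -sumrN; congr +%R; apply: eq_bigr => i _.
by rewrite -opprD mulNr.
Qed.

Let sign i : R := (-1) ^+ i.
Let f n p := alternating n `|p : R * R|.

(** Orthogonality is tested on the radial functions of [V] only.  Symmetry of
    the inner product turns [g] into the test function of a radial weight, so
    that only its averages enter. *)
Lemma residual_average n g :
  pwlinear (square (rho n.+1)) (mesh rho n.+1) g ->
  (forall phi, pwlinear (square (rho n.+1)) (mesh rho n.+1) phi ->
     inner (square (rho n.+1)) (f n \- g) phi = 0) ->
  forall v : nat -> R, residual rho n.+1 sign (average rho g) v = 0.
Proof.
move=> gV gorth v; have r0 := rho_gt0 n.
have vV := radial_pwlinear rho0 rhoS n v.
have [mg [G gG]] := pwlinear_measurable_bounded rho0 rhoS gV.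
have [mv [B vB]] := pwlinear_measurable_bounded rho0 rhoS vV.
have tv : bm_supported (rho n.+1) (radial rho n.+1 v).
  by split=> //; [exists B|exact: radial_out].
have malt : measurable_fun [set: T2] (f n).
  exact: (measurableT_comp (measurable_alternating n) (@measurable_norm2 R)).
have := gorth _ vV; rewrite innerB//; last 2 first.
- by apply: bm_supported_mul => //; exists 1 => p; rewrite alternating_norm.
- by apply: bm_supported_mul => //; exists G.
have -> : inner (square (rho n.+1)) (f n) (radial rho n.+1 v) =
    2 / 3 * residual rho n.+1 sign (fun=> 0) (average rho (radial rho n.+1 v)).
  apply: (inner_residual rho0 rhoS (eta := alternating n)) => //.
  - exact: measurable_alternating.
  - by exists 1 => r; rewrite alternating_norm.
  - by move=> i r ni ir; rewrite (alternatingE ni ir) interp0 subr0.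
have -> : inner (square (rho n.+1)) g (radial rho n.+1 v) =
    2 / 3 * residual rho n.+1 (fun=> 0) (fun i => - v i) (average rho g).
  rewrite -(inner_residual rho0 rhoS (eta := interp rho n.+1 v))//.
  - by apply: eq_inner => p ps; rewrite radial_in// mulrC.
  - exact: measurable_interp.
  - exact: interp_bounded.
  - by move=> i r _ _; rewrite interpN sub0r opprK.
rewrite -mulrBr => /eqP; rewrite mulf_eq0 => /orP[|/eqP h]; first by lra.
rewrite -[RHS]h /residual -sumrB; apply: eq_bigr => i _.
rewrite (average_radial v (ltn_ord i)) (average_radial v (ltnW (ltn_ord i))).
by rewrite /cell; ring.
Qed.

(** A radial function whose values solve the reduced system makes the difference
    orthogonal to all of [V]: of a test function only its averages matter. *)
Lemma exists_projection n : exists g,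
  pwlinear (square (rho n.+1)) (mesh rho n.+1) g /\
  forall phi, pwlinear (square (rho n.+1)) (mesh rho n.+1) phi ->
    inner (square (rho n.+1)) (f n \- g) phi = 0.
Proof.
have [|x hx] := @exists_residual0 R rho n.+1 sign isT _ rhoS; first by rewrite rho0.
exists (radial rho n.+1 x); split; first exact: radial_pwlinear.
move=> phi phiV.
have [B xB] := interp_bounded rho n.+1 x.
rewrite (@eq_inner _ _ (fun p => alternating n `|p| - interp rho n.+1 x `|p|) _ phi); last first.
  by move=> p ps; rewrite /= radial_in.
rewrite (inner_residual rho0 rhoS (s := sign) (x := x)
  (eta := fun r => alternating n r - interp rho n.+1 x r))//.
- by rewrite hx mulr0.
- apply: measurable_funB; [exact: measurable_alternating|exact: measurable_interp].
- exists (1 + B) => r; apply: le_trans (ler_normB _ _) _.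
  by rewrite alternating_norm lerD2l.
- by move=> i r ni ir; rewrite (alternatingE ni ir).
Qed.

(** If the projection were bounded by [M], then so would be its values at the
    vertices and their averages, which solve the reduced system. *)
Lemma norm_projV_ge n (M : R) :
  (forall x, (forall v : nat -> R, residual rho n.+1 sign x v = 0) ->
     exists2 i, (i <= n.+1)%N & M < `|x i|) ->
  (M%:E <= norm_projV (square (rho n.+1)) (mesh rho n.+1))%E.
Proof.
move=> blowup; have r0 := rho_gt0 n.
set Q := square _; set T := mesh _ _; set g := projV Q T (f n).
have [gV gorth] : pwlinear Q T g /\
    forall phi, pwlinear Q T phi -> inner Q (f n \- g) phi = 0.
  exact: (getPex (exists_projection n)).
apply: (@le_trans _ _ (normLinf Q g)); last first.
  apply: ereal_sup_ubound; exists (f n) => //; split.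
    apply: measurable_funTS.
    exact: (measurableT_comp (measurable_alternating n) (@measurable_norm2 R)).
  by apply: normLinf_sign => // p; exact: alternating_norm.
rewrite leNgt; apply/negP => /ltW gM.
have [i ni] := blowup _ (residual_average gV gorth).
rewrite ltNge => /negP; apply.
have [gc _ _] := gV.
have gp k : `|g (corner k (rho i))| <= M.
  apply: (ae_le_square r0 gc gM).
  by rewrite /square/= norm_corner// rho_le.
rewrite /average normrM normfV (ger0_norm (ler0n R 4)) ler_pdivrMr//.
apply: le_trans (ler_norm_sum _ _ _) _.
apply: (@le_trans _ _ (\sum_(m < 4) M)); first by apply: ler_sum.
by rewrite sumr_const card_ord mulr_natr.
Qed.

End Final.

Section NestedSquares.
Variable R : realType.

Lemma radiusS (K : R) i : 1 < K -> radius K i < radius K i.+1.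
Proof.
by move=> K1; case: i => [|i] /=; rewrite ?expr0 ?ltr01// ltr_eXn2l.
Qed.

(** The least ratio allowed in [residual_blowup]. *)
Definition growth J : R := 1 + 8 * J.+2%:R ^+ 2.

Lemma growth_gt1 J : 1 < growth J.
Proof. by rewrite /growth ltrDl mulr_gt0// exprn_gt0// ltr0n. Qed.

Lemma nested_norm_ge J :
  ((2 * J)%N%:R%:E <=
    norm_projV (square (radius (growth J) J.+1)) (mesh (radius (growth J)) J.+1))%E.
Proof.
apply: norm_projV_ge => //.
  by move=> i; apply: radiusS; exact: growth_gt1.
by move=> x; apply: residual_blowup.
Qed.

Lemma radius_gt0 J : 0 < radius (growth J) J.+1.
Proof. by rewrite /= exprn_gt0// (lt_trans ltr01 (growth_gt1 J)). Qed.

Lemma nested_triangulation J :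
  triangulation (square (radius (growth J) J.+1)) (mesh (radius (growth J)) J.+1).
Proof.
by apply: mesh_triangulation => // i; apply: radiusS; exact: growth_gt1.
Qed.

End NestedSquares.

Theorem theorem1 (R : realType) :
  (forall J : nat, (1 <= J)%N ->
     exists (Q : set (R * R)) (T : set (set (R * R))),
       [/\ is_square Q, triangulation Q T, (T #= `I_(8 * J + 4))%card &
           ((2 * J)%N%:R%:E <= norm_projV Q T)%E]) /\
  C1 R = +oo%E.
Proof.
split=> [J _|].
  exists (square (radius (growth R J) J.+1)), (mesh (radius (growth R J)) J.+1); split.
  - exact/square_isquare/radius_gt0.
  - exact: nested_triangulation.
  - by apply: card_mesh => // i; apply: radiusS; exact: growth_gt1.
  - exact: nested_norm_ge.
apply/eqyP => A A0.
pose J := Num.trunc A.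
apply: (@le_trans _ _ (2 * J.+1)%N%:R%:E).
  rewrite lee_fin natrM; have := truncnS_gt A; rewrite -/J.
  have : 0 <= J.+1%:R :> R by [].
  lra.
apply: le_trans (nested_norm_ge R J.+1) _.
apply: ereal_sup_ubound.
exists (square (radius (growth R J.+1) J.+2)), (mesh (radius (growth R J.+1)) J.+2).
split=> //; last exact: nested_triangulation.
exact/square_polygonal/radius_gt0.
Qed.
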